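(* Let $(T, M)$ be a complete local ring such that (i) no integer of $T$ is a zerodivisor, and (ii) unless $M$ is equal to $(0)$, $M \notin \operatorname{Ass}(T)$. If $T/M$ is infinite, then $T$ is the completion of a local domain $A$ such that $|A| = |T/M|$. If $T/M$ is finite, then $T$ is the completion of a countable local domain.
   Context: All rings are commutative with $1$. ''Local'' means Noetherian with exactly one maximal ideal; $(T,M)$ local means $M$ is the maximal ideal of $T$; ''complete'' means complete with respect to the $M$-adic topology. For a local ring $(A,\mathfrak m)$, ''$T$ is the completion of $A$'' means that the $\mathfrak m$-adic completion $\widehat A$ is isomorphic to $T$. $\operatorname{Ass}(T)$ is the set of associated primes of the $T$-module $T$. An integer of $T$ is an element of the prime subring $\mathbb Z\cdot 1_T$; $0$ is not counted as a zerodivisor, so condition (i) says that no nonzero element of $\mathbb Z\cdot 1_T$ is a zerodivisor in $T$. ''Countable'' means finite or countably infinite. *)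

(* Defs.v *)
From HB Require Import structures.
From mathcomp Require Import all_boot all_order all_algebra.
From mathcomp Require Import all_classical.

Set Implicit Arguments.
Unset Strict Implicit.
Unset Printing Implicit Defensive.

Import GRing.Theory.
Local Open Scope classical_set_scope.
Local Open Scope ring_scope.

(* Maximal and prime ideals are carried by the library's structure [idealr R],
   whose inhabitants are the proper ideals of [R]; ideals that may be the whole
   ring (arbitrary ideals, and the powers of an ideal) are sets. *)

Section Ideals.
Variable R : comNzRingType.

Definition is_ideal (I : set R) : Prop :=
  [/\ I 0, forall x y, I x -> I y -> I (x + y) & forall a x, I x -> I (a * x)].

Definition ideal_span (s : seq R) : set R :=
  [set x | exists c : nat -> R, x = \sum_(i < size s) c i * s`_i].

Definition noetherian : Prop :=
  forall I : set R, is_ideal I -> exists s : seq R, I = ideal_span s.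

Definition maximal_ideal (M : idealr R) : Prop :=
  forall I : idealr R, {subset M <= I} -> I =i M.

Definition is_local (M : idealr R) : Prop :=
  [/\ noetherian, maximal_ideal M &
      forall N : idealr R, maximal_ideal N -> N =i M].

Definition zero_divisor (a : R) : Prop := exists2 y : R, y != 0 & a * y = 0.

(* [P] is a prime ideal of the form Ann(x). *)
Definition associated_prime (P : idealr R) : Prop :=
  prime_idealr_closed P /\ exists x : R, forall a : R, a \in P <-> a * x = 0.

Definition ideal_mul (I J : set R) : set R :=
  [set x | exists n (a b : 'I_n -> R),
     (forall i, I (a i) /\ J (b i)) /\ x = \sum_(i < n) a i * b i].

Definition ideal_pow (I : set R) (k : nat) : set R := iter k (ideal_mul I) setT.

Definition adic_cauchy (I : idealr R) (u : nat -> R) : Prop :=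
  forall k, exists N, forall i j, (N <= i)%N -> (N <= j)%N ->
    ideal_pow [set` I] k (u i - u j).

Definition adic_cvg (I : idealr R) (u : nat -> R) (l : R) : Prop :=
  forall k, exists N, forall i, (N <= i)%N -> ideal_pow [set` I] k (u i - l).

(* Hausdorff, and every Cauchy sequence converges. *)
Definition adic_complete (I : idealr R) : Prop :=
  (forall x, (forall k, ideal_pow [set` I] k x) -> x = 0) /\
  (forall u, adic_cauchy I u -> exists l, adic_cvg I u l).

Lemma ideal_powP (I : idealr R) k : is_ideal (ideal_pow [set` I] k).
Proof.
elim: k => [|k _]; first by split.
split=> /=.
- exists 0%N, (fun=> 0), (fun=> 0); split; first by case.
  by rewrite big_ord0.
- move=> x y [n [a [b [hab ->]]]] [m [c [d [hcd ->]]]].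
  exists (n + m)%N, (fun i : 'I_(n + m) => match fintype.split i with inl j => a j | inr j => c j end),
    (fun i : 'I_(n + m) => match fintype.split i with inl j => b j | inr j => d j end).
  split; first by move=> i; case: (fintype.split i).
  rewrite big_split_ord /=; congr (_ + _); apply: eq_bigr => i _.
    by rewrite (unsplitK (inl i)).
  by rewrite (unsplitK (inr i)).
- move=> r x [n [a [b [hab ->]]]].
  exists n, (fun i => r * a i), b; split; last first.
    by rewrite mulr_sumr; apply: eq_bigr => i _; rewrite mulrA.
  by move=> i; have [ha hb] := hab i; split=> //; apply: idealMr.
Qed.

Lemma ideal_pow1 (I : idealr R) x : ideal_pow [set` I] 1 x -> x \in I.
Proof.
move=> [n [a [b [hab ->]]]]; apply: rpred_sum => i _.
by rewrite mulrC; apply: idealMr; have [] := hab i.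
Qed.

End Ideals.

(* The I-adic completion, as the ring of Cauchy sequences (a subring of the
   ring [nat -> R] with pointwise operations) modulo the null sequences. *)
Section Completion.
Variables (R : comNzRingType) (I : idealr R).

Local Notation pow := (ideal_pow [set` I]).

Let powD k x y : pow k x -> pow k y -> pow k (x + y).
Proof. by case: (ideal_powP I k) => _ h _; apply: h. Qed.

Let powM k a x : pow k x -> pow k (a * x).
Proof. by case: (ideal_powP I k) => _ _; apply. Qed.

Let powN k x : pow k x -> pow k (- x).
Proof. by rewrite -mulN1r; apply: powM. Qed.

Definition cauchy_pred : {pred nat -> R} := fun u => `[< adic_cauchy I u >].

Lemma cauchy_subring : subring_closed cauchy_pred.
Proof.
split.
- apply/asboolP => k; exists 0%N => i j _ _.
  by rewrite subrr; case: (ideal_powP I k).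
- move=> u v /asboolP hu /asboolP hv; apply/asboolP => k.
  have [N1 h1] := hu k; have [N2 h2] := hv k.
  exists (maxn N1 N2) => i j; rewrite !geq_max => /andP[i1 i2] /andP[j1 j2].
  have -> : (u - v) i - (u - v) j = (u i - u j) + - (v i - v j).
    change (u i - v i - (u j - v j) = (u i - u j) + - (v i - v j)).
    by rewrite opprB [v j - u j]addrC addrACA [- v i + v j]addrC opprB.
  by apply: powD; [apply: h1 | apply/powN/h2].
- move=> u v /asboolP hu /asboolP hv; apply/asboolP => k.
  have [N1 h1] := hu k; have [N2 h2] := hv k.
  exists (maxn N1 N2) => i j; rewrite !geq_max => /andP[i1 i2] /andP[j1 j2].
  have -> : (u * v) i - (u * v) j = u i * (v i - v j) + v j * (u i - u j).
    by rewrite mulrBr mulrBr [v j * u i]mulrC [v j * u j]mulrC addrA subrK.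
  by apply: powD; apply: powM; [apply: h2 | apply: h1].
Qed.

HB.instance Definition _ :=
  GRing.isSubringClosed.Build (nat -> R) cauchy_pred cauchy_subring.

Record cauchy_seq := CauchySeq {
  cauchy_val :> nat -> R;
  cauchy_valP : cauchy_val \in cauchy_pred
}.

HB.instance Definition _ := [isSub for cauchy_val].
HB.instance Definition _ := [Choice of cauchy_seq by <:].
HB.instance Definition _ := [SubChoice_isSubComNzRing of cauchy_seq by <:].

Definition null_pred : {pred cauchy_seq} := fun u => `[< adic_cvg I u 0 >].

Lemma null_idealr : idealr_closed null_pred.
Proof.
split.
- apply/asboolP => k; exists 0%N => i _.
  by rewrite subr0; case: (ideal_powP I k).
- apply/negP => /asboolP /(_ 1%N) [N /(_ N (leqnn N))].
  by rewrite subr0 => /ideal_pow1; rewrite idealr1.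
- move=> a u v /asboolP hu /asboolP hv; apply/asboolP => k.
  have [N1 h1] := hu k; have [N2 h2] := hv k.
  exists (maxn N1 N2) => i; rewrite geq_max => /andP[i1 i2].
  have := h1 i i1; have := h2 i i2; rewrite !subr0 => hvi hui.
  by apply: (powD _ hvi); apply: powM.
Qed.

HB.instance Definition _ := isIdealr.Build cauchy_seq null_pred null_idealr.

Definition adic_completion : comNzRingType := {ideal_quot null_pred}.

End Completion.

Definition is_completion (T A : comNzRingType) (m : idealr A) : Prop :=
  exists f : {rmorphism adic_completion m -> T}, bijective f.

(* Main.v *)
Require Import Defs.
From HB Require Import structures.
From mathcomp Require Import all_boot all_order all_algebra.
From mathcomp Require Import all_classical.
From mathcomp Require Import finmap wochoice ring.

(** The idea is to find a subring [A] of [T] with four properties: no nonzero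
element of [A] is a zero divisor of [T]; [A] maps onto [T / M]; [A] contains
generators of [M]; and a linear equation with coefficients in [A] that is
solvable in [T] is solvable in [A], which says that [I T] meets [A] in [I] for
every finitely generated ideal [I] of [A]. Such an [A] is a local domain with
completion [T]. It is Noetherian because the extension to [T] of an ideal [J]
of [A] is generated by finitely many elements of [J], and these generate [J]
after contraction. Its elements outside [M] are units because the equation
[a x = 1] is solvable. With [m] the intersection of [A] and [M], the ideal
[M ^ k] is the extension of [m ^ k] and contracts back to it, while [A] is
dense in [T], so the completion of [A] maps isomorphically onto [T]
([elt_is_local], [elt_is_completion]).

When [M] is zero, [A] can be all of [T]. Otherwise prime avoidance gives a
regular [z] in [M], and [A] is built by transfinite recursion along a
well-order of [T] whose proper initial segments are smaller than [T]. Each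
stage receives a task, an element and a finite list of elements of [T]. It
adjoins an element of the class of the former modulo [z ^ 2 T], and makes it a
combination of the latter if this is meaningful and possible in [T]. Tasks are
scheduled so that each returns at arbitrarily late stages, when the elements it
mentions have already entered the subring.

Only two kinds of adjunction occur, and both create no zero divisors: quotients
of elements already present, and elements [t + a x] with [a] regular and [x]
chosen generic ([exists_transcendental], [solve_membership]). Genericity is a
count. The series [\sum_i u_i z ^ i], with the [u_i] representatives of
residues, give as many elements as [T] has, with all differences regular.
A nonzero polynomial [p] over the current subring takes a zero divisor as value
at only finitely many of the resulting points [t + a x], since zero divisors lie
in finitely many maximal associated primes and modulo each of them the points
stay distinct, so that more than [deg p] of them would force the coefficients of
[p], which are zero or regular, to vanish modulo the prime. As the subring at
hand has fewer elements than [T], some point is good for all [p].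

The subring so obtained may be as large as [T]. Closing representatives of the
residue field and generators of [M] under the ring operations and under solving
linear equations inside it cuts it down to at most [max(|T / M|, aleph_0)]
elements, without loss of the four properties ([completing_shrink]). The
cardinal arithmetic rests on [|X * X| = |X|] for infinite [X]
([embeds_square]). *)

Set Implicit Arguments.
Unset Strict Implicit.
Unset Printing Implicit Defensive.

Import GRing.Theory.
Local Open Scope classical_set_scope.
Local Open Scope ring_scope.
Local Open Scope card_scope.


(** * Comparing the sizes of types *)

Definition embeds (X Y : Type) : Prop := exists f : X -> Y, injective f.

Lemma embeds_refl X : embeds X X.
Proof. by exists id. Qed.

Lemma embeds_trans Y X Z : embeds X Y -> embeds Y Z -> embeds X Z.
Proof. by move=> [f fi] [g gi]; exists (g \o f); exact: inj_comp. Qed.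

Lemma sval_inj X (P : X -> Prop) : injective (@sval X P).
Proof. by move=> [x Px] [y Py] /= xy; exact: eq_exist. Qed.

Lemma embeds_sval X (P : X -> Prop) : embeds {x | P x} X.
Proof. by exists sval; exact: sval_inj. Qed.

Lemma embeds_prod X X' Y Y' :
  embeds X Y -> embeds X' Y' -> embeds (X * X') (Y * Y').
Proof.
move=> [f fi] [g gi]; exists (fun p => (f p.1, g p.2)).
by move=> [a b] [c d] [/fi -> /gi ->].
Qed.

Lemma embeds_sum X X' Y Y' :
  embeds X Y -> embeds X' Y' -> embeds (X + X') (Y + Y').
Proof.
move=> [f fi] [g gi].
exists (fun p => match p with inl x => inl (f x) | inr y => inr (g y) end).
by move=> [a|a] [b|b] //= [] => [/fi|/gi] ->.
Qed.

Lemma embeds_seq X Y : embeds X Y -> embeds (seq X) (seq Y).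
Proof. by move=> [f fi]; exists (map f); exact: inj_map. Qed.

Lemma embeds_of_surj X Y (f : X -> Y) :
  (forall y, exists x, f x = y) -> embeds Y X.
Proof.
by move=> /choice[g gK]; exists g; exact: can_inj gK.
Qed.

Lemma embeds_cardP X Y : embeds X Y <-> [set: X] #<= [set: Y].
Proof.
split=> [[f fi]|/card_leP/injfunPex[f _ fi]].
  have /card_eqPle[_ XfX] := inj_card_eq (in2W fi : {in [set: X] &, injective f}).
  exact: card_le_trans XfX (subset_card_le (@subsetT _ _)).
exists (fun x => val (f (SigSub (mem_set (I : [set: X] x))))) => x y /val_inj.
by move=> /fi -/(_ (mem_set I) (mem_set I)) [].
Qed.

Lemma infinite_embeds X : infinite_set [set: X] <-> embeds nat X.
Proof. by split=> [/infiniteP/embeds_cardP|/embeds_cardP/infiniteP]. Qed.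

Lemma countable_embeds X : countable [set: X] <-> embeds X nat.
Proof. by split=> /embeds_cardP. Qed.

Lemma finite_embeds_nat X : ~ embeds nat X -> embeds X nat.
Proof.
move=> nX; apply/countable_embeds/finite_set_countable.
by apply: contrapT => /infinite_embeds.
Qed.

(** * Well-orders *)

Record strict_wo (X : Type) (lt : X -> X -> Prop) : Prop := StrictWo {
  wo_wf : well_founded lt;
  wo_trans : forall x y z, lt x y -> lt y z -> lt x z;
  wo_total : forall x y, [\/ x = y, lt x y | lt y x] }.

Definition seg (X : Type) (lt : X -> X -> Prop) (x : X) := {y | lt y x}.

Lemma wo_preim X Y (lt : X -> X -> Prop) (f : Y -> X) :
  injective f -> strict_wo lt -> strict_wo (fun y z => lt (f y) (f z)).
Proof.
move=> fi [wf tr tot]; split.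
- move=> y; move: {2}(f y) (erefl (f y)) => x; elim: x / (wf x) y => x _ IH y fyx.
  by split=> z; rewrite fyx => zx; apply: (IH _ zx).
- by move=> x y z; exact: tr.
- by move=> x y; have [/fi -> | h | h] := tot (f x) (f y); [constructor 1|constructor 2|constructor 3].
Qed.

Lemma exists_strict_wo X : exists lt : X -> X -> Prop, strict_wo lt.
Proof.
elim/Peq : X => X; have [R Rwo] := well_ordering_principle X.
have Rmin (A : {pred X}) : (exists x, x \in A) ->
    exists2 z, z \in A & {in A, forall x, R z x}.
  by move=> /Rwo[z [[zA zmin] _]]; exists z.
have Rwo' : wo_chain R predT by move=> A _; apply: Rwo.
have Rtot x y : R x y || R y x by exact: (wo_chainW Rwo').
have Ranti x y : R x y -> R y x -> x = y.
  by move=> xy yx; apply: (wo_chain_antisymmetric Rwo') => //; rewrite xy yx.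
exists (fun x y => ~~ R y x); split.
- move=> x; apply: contrapT => nx.
  have [|z /asboolP nz zmin] := Rmin (fun y => `[< ~ Acc (fun x y => ~~ R y x) y >]).
    by exists x; apply/asboolP.
  apply: nz; split=> y nyz; apply: contrapT => ny.
  by move/negP: nyz; apply; apply: zmin; apply/asboolP.
- move=> x y z nyx nzy; apply/negP => zx.
  have [|w] := Rmin [predU1 x & [predU1 y & pred1 z]].
    by exists x; rewrite !inE eqxx.
  rewrite !inE => /or3P[]/eqP-> h.
  + have xz : x = z by apply: Ranti => //; apply: h; rewrite !inE eqxx !orbT.
    by move: nzy; rewrite -xz h // !inE eqxx orbT.
  + by move/negP: nyx; apply; apply: h; rewrite inE eqxx.
  + by move/negP: nzy; apply; apply: h; rewrite !inE eqxx orbT.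
- move=> x y; have [xy|/negP nxy] := pselect (R x y); last by constructor 3.
  have [yx|/negP nyx] := pselect (R y x); last by constructor 2.
  by constructor 1; exact: Ranti.
Qed.

(** The first proper segment into which [X] embeds, if there is one, carries
an order that can be pulled back to [X]; minimality makes the segments of the
new order too small to contain a copy of [X]. *)
Lemma exists_initial_wo X : exists lt : X -> X -> Prop,
  strict_wo lt /\ forall x, ~ embeds X (seg lt x).
Proof.
have [lt ltwo] := exists_strict_wo X.
have [[s sX]|nX] := pselect (exists s, embeds X (seg lt s)); last first.
  by exists lt; split=> // x xX; apply: nX; exists x.
elim: s / (wo_wf ltwo s) sX => s _ IH [f fi].
have [[r rs rX]|nr] := pselect (exists2 r, lt r s & embeds X (seg lt r)).
  exact: (IH _ rs rX).
have gi : injective (fun x => sval (f x)) by move=> x y /sval_inj/fi.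
exists (fun x y => lt (sval (f x)) (sval (f y))); split; first exact: wo_preim gi ltwo.
move=> x xX; apply: nr; exists (sval (f x)); first exact: (svalP (f x)).
apply: embeds_trans xX _.
exists (fun y => exist (lt^~ (sval (f x))) (sval (f (sval y))) (svalP y)).
by move=> [y yx] [z zx] [/gi yz]; exact: eq_exist.
Qed.

(** Each point is sent to a value not taken before. A value remains available
because a segment mapping onto [X] would contain a copy of [X]. *)
Lemma embeds_by_recursion P X (lt : P -> P -> Prop) : strict_wo lt ->
  (forall p, ~ embeds X (seg lt p)) -> embeds P X.
Proof.
elim/Pchoice: X => X ltwo noX.
have [[x0 _]|X0] := pselect (exists x : X, True); last first.
  have noP (p : P) : False.
    apply: (noX p); exists (fun x => False_rect _ (X0 (ex_intro _ x Logic.I))).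
    by move=> x; case: X0; exists x.
  by exists (fun p => False_rect _ (noP p)) => p; case: (noP p).
pose F p (rec : forall q, lt q p -> X) : X :=
  xget x0 [set x | forall q (qp : lt q p), rec q qp <> x].
pose f := Fix (wo_wf ltwo) (fun=> X) F.
have fE p : f p = xget x0 [set x | forall q, lt q p -> f q <> x].
  rewrite /f Fix_eq // => {}p g h gh; rewrite /F; congr xget.
  by apply/seteqP; split=> x hx q qp; [rewrite -gh|rewrite gh]; exact: hx.
have fnew p q : lt q p -> f q <> f p.
  rewrite [f p]fE; case: xgetP => [x _ /(_ q)//|nx].
  exfalso; apply: (noX p).
  have /choice[g gP] : forall x, exists q, lt q p /\ f q = x.
    move=> x; apply: contrapT => nq; apply: (nx x) => r rp frx; apply: nq.
    by exists r.
  exists (fun x => exist (lt^~ p) (g x) (gP x).1) => x y [gxy].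
  by rewrite -(gP x).2 -(gP y).2 gxy.
exists f => p q fpq; have [//|pq|qp] := wo_total ltwo p q.
  by case: (fnew _ _ pq).
by case: (fnew _ _ qp).
Qed.

(** * Infinite types absorb finitary constructions *)

Definition lexi A B (ltA : A -> A -> Prop) (ltB : B -> B -> Prop) (p q : A * B) :=
  ltA p.1 q.1 \/ p.1 = q.1 /\ ltB p.2 q.2.

Lemma wo_lexi A B (ltA : A -> A -> Prop) (ltB : B -> B -> Prop) :
  strict_wo ltA -> strict_wo ltB -> strict_wo (lexi ltA ltB).
Proof.
move=> [wfA trA totA] [wfB trB totB]; split.
- move=> [a b]; elim: a / (wfA a) b => a _ IHa b; elim: b / (wfB b) => b _ IHb.
  by split=> -[c d] [/= ca|/= [-> db]]; [exact: IHa|exact: IHb].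
- move=> [a b] [c d] [e f] [/= ac|/= [<- bd]] [/= ce|/= [<- df]].
  + by left; exact: trA ac ce.
  + by left.
  + by left.
  + by right; split=> //; exact: trB bd df.
- move=> [a b] [c d]; have [<-|ac|ca] := totA a c.
  + have [<-|bd|db] := totB b d; first by constructor 1.
      by constructor 2; right.
    by constructor 3; right.
  + by constructor 2; left.
  + by constructor 3; left.
Qed.

Lemma embeds_option X : embeds nat X -> embeds (X * X) X -> embeds (option X) X.
Proof.
move=> [c ci] sqX; apply: embeds_trans sqX.
exists (fun o => if o is Some x then (x, x) else (c 0%N, c 1%N)).
move=> [x|] [y|] //= [].
- by move=> -> .
- by move=> -> /ci.
- by move=> <- /ci.
Qed.

Lemma embeds_closed_seg X (lt : X -> X -> Prop) m :
  embeds {x | x = m \/ lt x m} (option (seg lt m)).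
Proof.
exists (fun p => match pselect (lt (sval p) m) with
  | left h => Some (exist (lt^~ m) (sval p) h) | right _ => None end).
move=> [x xm] [y ym] /=; case: pselect => hx.
  by case: pselect => hy // -[xy]; exact: eq_exist.
case: pselect => hy // _; apply: eq_exist.
by case: xm ym => [->|//] [->|//].
Qed.

(** The maximum of the two coordinates is compared first, so the pairs that
precede [p] all lie in a square whose side is a segment of [X]; such a square
is too small to contain a copy of [X], and recursion applies. *)
Lemma embeds_square_step X (lt : X -> X -> Prop) : strict_wo lt ->
  (forall s, embeds nat (seg lt s) -> embeds (seg lt s * seg lt s) (seg lt s)) ->
  embeds nat X -> embeds (X * X) X.
Proof.
move=> ltwo sqs natX.
have [[s Xs]|noX] := pselect (exists s, embeds X (seg lt s)).
  apply: embeds_trans (embeds_prod Xs Xs) _.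
  by apply: embeds_trans (embeds_sval _); apply: sqs; exact: embeds_trans natX Xs.
pose gmax (p : X * X) := if pselect (lt p.1 p.2) then p.2 else p.1.
have gmaxP p : (p.1 = gmax p \/ lt p.1 (gmax p)) /\ (p.2 = gmax p \/ lt p.2 (gmax p)).
  rewrite /gmax; case: pselect => h /=; first by split; [right|left].
  split; first by left.
  by have [|//|] := wo_total ltwo p.1 p.2; [left|right].
have keyi : injective (fun p => (gmax p, p)) by move=> p q [].
have gwo := wo_preim keyi (wo_lexi ltwo (wo_lexi ltwo ltwo)).
apply: (embeds_by_recursion gwo) => p.
set m := gmax p; set Y := option (seg lt m) => Xp.
have {Xp} XYY : embeds X (Y * Y).
  apply: embeds_trans Xp _; pose C := {x | x = m \/ lt x m}.
  suff : embeds (seg (fun y z => lexi lt (lexi lt lt) (gmax y, y) (gmax z, z)) p) (C * C).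
    by move/embeds_trans; apply; apply: embeds_prod; exact: embeds_closed_seg.
  have le_m q : lexi lt (lexi lt lt) (gmax q, q) (gmax p, p) ->
      (q.1 = m \/ lt q.1 m) /\ (q.2 = m \/ lt q.2 m).
    have [q1 q2] := gmaxP q; case=> /= [qp|[qp _]]; last by rewrite /m -qp.
    have lt_m x : x = gmax q \/ lt x (gmax q) -> x = m \/ lt x m.
      by case=> [->|h]; right=> //; exact: (wo_trans ltwo h qp).
    by split; exact: lt_m.
  exists (fun q => (exist _ _ (le_m _ (svalP q)).1, exist _ _ (le_m _ (svalP q)).2) : C * C).
  move=> [[a b] ab] [[c d] cd] /= [ac bd]; apply: eq_exist.
  by rewrite ac bd.
have [natm|nm] := pselect (embeds nat (seg lt m)).
  apply: noX; exists m; apply: embeds_trans XYY _.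
  apply: embeds_trans (sqs m natm).
  by apply: embeds_prod; exact: embeds_option (sqs m natm).
have fin : finite_set [set: seg lt m] by apply: contrapT => /infinite_embeds.
have finY : finite_set [set: Y].
  apply: (@sub_finite_set _ _ (None |` (Some @` [set: seg lt m]))).
    by move=> [x|] _; [right; exists x|left].
  by rewrite finite_setU; split; [exact: finite_set1|exact: finite_image].
move/infinite_embeds: natX; apply.
apply: card_le_finite (finite_setX finY finY).
by have /embeds_cardP := XYY; rewrite -setXTT.
Qed.

(** By induction along a well-order of [X], every infinite segment absorbs its
square: its own segments are segments of [X], for which this is known. *)
Lemma embeds_square X : embeds nat X -> embeds (X * X) X.
Proof.
have [lt ltwo] := exists_strict_wo X.
apply: (embeds_square_step ltwo) => s.
elim: s / (wo_wf ltwo s) => s _ IH.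
pose lts (x y : seg lt s) := lt (sval x) (sval y).
have ltswo : strict_wo lts by exact: wo_preim (@sval_inj _ _) ltwo.
apply: (embeds_square_step ltswo) => -[r rs].
have ab : embeds (seg lts (exist _ r rs)) (seg lt r).
  exists (fun y => exist (lt^~ r) (sval (sval y)) (svalP y)).
  by move=> y z [yz]; do 2 apply: sval_inj.
have ba : embeds (seg lt r) (seg lts (exist _ r rs)).
  pose h (y : seg lt r) : seg lt s := exist _ (sval y) (wo_trans ltwo (svalP y) rs).
  exists (fun y => exist (lts^~ (exist _ r rs)) (h y) (svalP y)).
  by move=> y z [yz]; apply: sval_inj.
move=> nats; apply: embeds_trans (embeds_prod ab ab) _; apply: embeds_trans ba.
by apply: IH => //; exact: embeds_trans nats ab.
Qed.

Section Absorption.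
Variable X : Type.
Hypothesis natX : embeds nat X.

Lemma embeds_prod_le Y Z : embeds Y X -> embeds Z X -> embeds (Y * Z) X.
Proof. by move=> YX ZX; apply: embeds_trans (embeds_prod YX ZX) (embeds_square natX). Qed.

Lemma embeds_sum_le Y Z : embeds Y X -> embeds Z X -> embeds (Y + Z) X.
Proof.
move=> YX ZX; apply: embeds_trans (embeds_sum YX ZX) _.
apply: embeds_trans (embeds_square natX); have [c ci] := natX.
apply: (@embeds_trans (nat * X)); last exact: embeds_prod natX (embeds_refl _).
exists (fun u => match u with inl x => (0%N, x) | inr x => (1%N, x) end).
by move=> [x|x] [y|y] // [->].
Qed.

(** The length is recorded first, so that a code built by iterated pairing can
be read back. *)
Lemma embeds_seq_le Y : embeds Y X -> embeds (seq Y) X.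
Proof.
move=> /embeds_seq/embeds_trans; apply.
have [p pi] := embeds_square natX; have [c ci] := natX.
pose code (s : seq X) := foldr (fun x acc => p (x, acc)) (c 0%N) s.
apply: (@embeds_trans (nat * X)); last exact: embeds_trans (embeds_prod natX (embeds_refl _)) (embeds_square natX).
exists (fun s => (size s, code s)) => s t [].
elim: s t => [|x s IH] [|y t] //= [st] /pi[<- /IH -> //].
Qed.

Lemma embeds_tree_le Y : embeds Y X -> embeds (GenTree.tree Y) X.
Proof.
move=> YX; apply: (@embeds_trans (seq (nat + Y))).
  by exists (@GenTree.encode Y); exact: pcan_inj (@GenTree.codeK Y).
exact: embeds_seq_le (embeds_sum_le natX YX).
Qed.

End Absorption.

(** * Ideals of Noetherian rings *)

Section Ideals.
Variable R : comNzRingType.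
Implicit Types (I J : set R) (s : seq R).

Lemma is_ideal_span s : is_ideal (ideal_span s).
Proof.
split.
- exists (fun=> 0); rewrite big1 // => i _; exact: mul0r.
- move=> _ _ [c ->] [d ->]; exists (fun i => c i + d i).
  by rewrite -big_split /=; apply: eq_bigr => i _; rewrite mulrDl.
- move=> a _ [c ->]; exists (fun i => a * c i).
  by rewrite mulr_sumr; apply: eq_bigr => i _; rewrite mulrA.
Qed.

Lemma mem_ideal_span s x : x \in s -> ideal_span s x.
Proof.
move=> xs; exists (fun i => (i == index x s)%:R).
have lt : (index x s < size s)%N by rewrite index_mem.
rewrite (bigD1 (Ordinal lt)) //= eqxx mul1r nth_index // big1 ?addr0 // => i ne.
by rewrite (_ : (i == _ :> nat) = false) ?mul0r //; exact: negbTE.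
Qed.

Lemma ideal_sum I : is_ideal I -> forall (K : Type) (r : seq K) (P : pred K) F,
  (forall i, P i -> I (F i)) -> I (\sum_(i <- r | P i) F i).
Proof. by move=> [I0 ID _] K r P F IF; apply: big_ind. Qed.

Lemma ideal_span_sub I s : is_ideal I -> (forall x, x \in s -> I x) ->
  ideal_span s `<=` I.
Proof.
move=> II sI x [c ->]; apply: ideal_sum => // i _.
by case: II => _ _; apply; apply: sI; exact: mem_nth.
Qed.

Lemma ideal_span_consP a s x :
  ideal_span (a :: s) x <-> exists c y, ideal_span s y /\ x = c * a + y.
Proof.
split=> [[c ->]|[c [y [[d ->] ->]]]].
- exists (c 0%N), (\sum_(i < size s) c i.+1 * s`_i); split; first by exists (fun i => c i.+1).
  by rewrite big_ord_recl.
- by exists (fun i => if i is i'.+1 then d i' else c); rewrite /= big_ord_recl.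
Qed.

Lemma idealN I : is_ideal I -> forall x, I x -> I (- x).
Proof. by case=> _ _ IM x /(IM (-1)); rewrite mulN1r. Qed.

Lemma idealB I : is_ideal I -> forall x y, I x -> I y -> I (x - y).
Proof. by move=> II x y Ix /(idealN II); case: II => _ ID _; exact: ID. Qed.

Definition ideal_pred I : {pred R} := fun x => `[< I x >].

Lemma ideal_predP I : is_ideal I -> ~ I 1 -> idealr_closed (ideal_pred I).
Proof.
move=> [I0 ID IM] I1; split.
- exact/asboolP.
- exact/asboolP.
- by move=> a u v /asboolP Iu /asboolP Iv; apply/asboolP/ID => //; exact: IM.
Qed.

Definition idealr_of I (II : is_ideal I) (I1 : ~ I 1) : idealr R :=
  HB.pack (ideal_pred I) (isIdealr.Build R (ideal_pred I) (ideal_predP II I1)).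

Lemma in_idealr_of I (II : is_ideal I) (I1 : ~ I 1) x : x \in idealr_of II I1 <-> I x.
Proof. by split=> /asboolP. Qed.

Lemma idealr_is_ideal (I : idealr R) : is_ideal [set` I].
Proof.
split=> /=; first exact: idealr0.
- by move=> x y; exact: rpredD.
- by move=> a x; exact: idealMr.
Qed.

Hypothesis noethR : noetherian R.

(** The union of a chain of ideals is finitely generated, so its generators
all lie in one member of the chain, which is then the whole union. *)
Lemma noetherian_maximal (F : set (set R)) (I0 : set R) :
  F `<=` @is_ideal R -> F I0 ->
  exists J, F J /\ forall K, F K -> J `<=` K -> K `<=` J.
Proof.
move=> Fid FI0.
have [|J [[J0|FJ] Jmax]] := @Zorn_bigcup R [set X | X = set0 \/ F X]; last first.
- exists J; split=> // K FK JK x Kx; apply: contrapT => nJx.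
  by apply: (Jmax K) => //; [split=> // /(_ x Kx)|right].
- exfalso; apply: (Jmax I0); last by right.
  rewrite J0; split=> // /(_ 0); apply.
  by case: (Fid _ FI0).
move=> C CF Ctot /=; set U := \bigcup_(X in C) X.
have [[X [CX X0]]|nX] := pselect (exists X, C X /\ X != set0); last first.
  left; apply/seteqP; split=> // x [X CX Xx]; apply: nX; exists X; split=> //.
  by apply/eqP => X0; rewrite X0 in Xx.
have CFx Y y : C Y -> Y y -> F Y.
  by move=> CY Yy; case: (CF _ CY) => // Y0; rewrite Y0 in Yy.
have FX : F X by case: (CF _ CX) X0 => [->|//]; rewrite eqxx.
have U_id : is_ideal U.
  split.
  - by exists X => //; case: (Fid _ FX).
  - move=> x y [Y CY Yx] [Z CZ Zy]; have [YZ|ZY] := Ctot _ _ CY CZ.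
      by exists Z => //; case: (Fid _ (CFx _ _ CZ Zy)) => _ + _; apply => //; exact: YZ.
    by exists Y => //; case: (Fid _ (CFx _ _ CY Yx)) => _ + _; apply => //; exact: ZY.
  - move=> a x [Y CY Yx]; exists Y => //.
    by case: (Fid _ (CFx _ _ CY Yx)) => _ _; apply.
have [s Us] := noethR U_id.
have [Y CY sY] : exists2 Y, C Y /\ F Y & forall x, x \in s -> Y x.
  have : forall x, x \in s -> U x by move=> x /mem_ideal_span; rewrite -Us.
  elim: s {Us} => [|x s IH] sU; first by exists X.
  have [|Y [CY FY] sY] := IH; first by move=> y ys; apply: sU; rewrite inE ys orbT.
  have [Z CZ Zx] := sU x (mem_head _ _).
  have [YZ|ZY] := Ctot _ _ CY CZ.
    exists Z; first by split=> //; exact: CFx CZ Zx.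
    by move=> y; rewrite inE => /orP[/eqP->//|/sY/YZ].
  by exists Y => // y; rewrite inE => /orP[/eqP->|/sY//]; exact: ZY.
case: CY => CY FY; right; suff -> : U = Y by [].
apply/seteqP; split; last exact: bigcup_sup.
by rewrite Us; apply: ideal_span_sub => //; exact: Fid.
Qed.

(** A maximal ideal among those spanned by finitely many elements of [B] swallows
each element of [B]. *)
Lemma noetherian_finite_subset (B : set R) : exists s : seq R,
  (forall x, x \in s -> B x) /\ B `<=` ideal_span s.
Proof.
pose F := [set ideal_span s | s in [set s : seq R | forall x, x \in s -> B x]].
have [| |_ [[s sB <-] smax]] := @noetherian_maximal F (ideal_span [::]).
- by move=> _ [s _ <-]; exact: is_ideal_span.
- by exists [::].
exists s; split=> // b Bb; apply: (smax (ideal_span (b :: s))).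
- exists (b :: s) => // x /=; rewrite inE => /orP[/eqP->//|]; exact: sB.
- by apply: ideal_span_sub => [|x xs]; [exact: is_ideal_span|apply: mem_ideal_span; rewrite inE xs orbT].
- by apply: mem_ideal_span; rewrite inE eqxx.
Qed.

(** * Zero divisors of a Noetherian ring *)

Definition ann_sub (x y : R) := forall a, a * x = 0 -> a * y = 0.

(** The annihilators of these elements are the maximal associated primes; the
elements themselves serve as names for the primes. *)
Definition max_ann (y : R) :=
  y <> 0 /\ forall y', y' <> 0 -> ann_sub y y' -> ann_sub y' y.

(** If [b] does not kill [y], then [b * y] has no larger annihilator than [y]. *)
Lemma max_ann_prime y a b : max_ann y -> a * b * y = 0 -> a * y = 0 \/ b * y = 0.
Proof.
move=> [y0 ymax] aby; have [->|/eqP by0] := eqVneq (b * y) 0; [by right|left].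
apply: (ymax (b * y) by0) => [c cy|]; last by rewrite mulrA.
by rewrite mulrCA cy mulr0.
Qed.

Lemma exists_max_ann x : x <> 0 -> exists2 y, max_ann y & ann_sub x y.
Proof.
move=> x0; pose F := [set [set a | a * y = 0] | y in [set y | y <> 0 /\ ann_sub x y]].
have [| |_ [[y [y0 xy] <-] ymax]] := @noetherian_maximal F [set a | a * x = 0].
- move=> _ [y _ <-]; split=> /=; first exact: mul0r.
  + by move=> a b ay b_y; rewrite mulrDl ay b_y addr0.
  + by move=> a b b_y; rewrite -mulrA b_y mulr0.
- by exists x; split.
exists y => //; split=> // y' y'0 yy'; apply: ymax => //.
by exists y' => //; split=> // a /xy/yy'.
Qed.

(** A product of elements chosen one in each [Ann y'] outside the prime [Ann y]. *)
Lemma max_ann_separate y (s : seq R) : max_ann y ->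
  (forall y', y' \in s -> ~ ann_sub y' y) ->
  exists2 w, w * y <> 0 & forall y', y' \in s -> w * y' = 0.
Proof.
move=> ymax; elim: s => [|x s IH] sy.
  by exists 1 => //; rewrite mul1r; case: ymax.
have [|w wy ws] := IH; first by move=> y' y's; apply: sy; rewrite inE y's orbT.
have [p [px py]] : exists p, p * x = 0 /\ p * y <> 0.
  apply: contrapT => np; apply: (sy x (mem_head _ _)) => p px.
  by apply: contrapT => py; apply: np; exists p.
exists (p * w) => [/(max_ann_prime ymax)[]//|y'].
rewrite inE => /orP[/eqP->|/ws y'w]; first by rewrite mulrAC px mul0r.
by rewrite -mulrA y'w mulr0.
Qed.

Lemma not_lregP (a : R) : ~ GRing.lreg a -> exists2 b, b <> 0 & a * b = 0.
Proof.
move=> nreg; apply: contrapT => nb; apply: nreg; apply: mulrI0_lreg => b ab.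
by apply: contrapT => b0; apply: nb; exists b.
Qed.

Lemma lreg_mul_neq0 (a b : R) : GRing.lreg a -> b <> 0 -> a * b <> 0.
Proof. by move=> areg b0 /eqP; rewrite mulrI_eq0 // => /eqP. Qed.

(** Finiteness of the maximal associated primes: pick finitely many [y] that
generate all elements with maximal annihilator. An annihilator [Ann y]
contains the intersection of the chosen ones, hence one of them, and the two
agree by maximality. *)
Lemma finite_max_ann : exists s : seq R, (forall y, y \in s -> max_ann y) /\
  forall a, ~ GRing.lreg a -> exists2 y, y \in s & a * y = 0.
Proof.
have [s [sB Bs]] := noetherian_finite_subset max_ann.
exists s; split=> // a /not_lregP[b b0 ab].
have [y ymax bys] := exists_max_ann b0.
have [[y' y's y'y]|ns] := pselect (exists2 y', y' \in s & ann_sub y' y).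
  exists y' => //; have [_ y'max] := sB _ y's.
  by apply: y'max (bys _ ab) => //; case: ymax.
have [y' y's|w wy ws] := @max_ann_separate y s ymax.
  by move=> y'y; apply: ns; exists y'.
case: wy; have [c ->] := Bs _ ymax; rewrite mulr_sumr big1 // => i _.
by rewrite mulrCA ws ?mulr0 //; exact: mem_nth.
Qed.

(** Prime avoidance for the primes [Ann y]. If the element [z] found for the
tail lies in the new prime, then by maximality no other prime is contained in
that one, so [z] can be corrected by an element of [M] that lies in all the
others and not in the new prime. *)
Lemma max_ann_avoidance (M : idealr R) (s : seq R) :
  (forall y, y \in s -> max_ann y) ->
  (forall y, y <> 0 -> exists2 a, a \in M & a * y <> 0) ->
  exists2 z, z \in M & forall y, y \in s -> z * y <> 0.
Proof.
move=> + Mann; elim: s => [|y s IH] smax; first by exists 0; [exact: idealr0|].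
have [|z zM zs] := IH; first by move=> x xs; apply: smax; rewrite inE xs orbT.
have ymax := smax y (mem_head _ _).
have [zy|/eqP zy] := eqVneq (z * y) 0; last first.
  by exists z => // x; rewrite inE => /orP[/eqP->|/zs].
have [i iM iy] := Mann y (proj1 ymax).
have [x xs xy|w wy ws] := @max_ann_separate y s ymax.
  have [|_ xmax] := smax x; first by rewrite inE xs orbT.
  by apply: (zs x xs); apply: xmax zy => //; case: ymax.
exists (z + w * i) => [|x]; first by rewrite rpredD // idealMr.
rewrite inE mulrDl => /orP[/eqP->|xs].
  by rewrite zy add0r => /(max_ann_prime ymax)[].
by rewrite mulrAC ws // mul0r addr0; exact: zs.
Qed.

End Ideals.

(** * Local rings *)

Section Local.
Variables (T : comNzRingType) (M : idealr T).
Hypothesis T_local : is_local M.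

(** A maximal proper ideal containing a non-unit is a maximal ideal, hence [M]. *)
Lemma local_unit x : x \notin M -> exists y, x * y = 1.
Proof.
case: T_local => noethT Mmax Muniq xM; apply: contrapT => nx.
pose F := [set I : set T | [/\ is_ideal I, ~ I 1 & I x]].
have [||J [[Jid J1 Jx] Jmax]] := @noetherian_maximal _ noethT F (ideal_span [:: x]).
- by move=> I [].
- split; first exact: is_ideal_span.
    by move=> [c]; rewrite big_ord1 /= => c1; apply: nx; exists (c 0%N); rewrite mulrC.
  by apply: mem_ideal_span; rewrite inE.
suff /Muniq/(_ x) : maximal_ideal (idealr_of Jid J1).
  by rewrite (negPf xM) => /negbT/negP; apply; exact/in_idealr_of.
move=> I JI a; apply/idP/idP; last exact: JI.
move=> aI; apply/in_idealr_of; apply: (Jmax [set` I]) => //; last first.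
  by move=> b Jb; apply: JI; apply/in_idealr_of.
split; first exact: idealr_is_ideal.
  by rewrite /= idealr1.
by apply: JI; apply/in_idealr_of.
Qed.

Lemma local_unitP x : x \notin M <-> exists y, x * y = 1.
Proof.
split; first exact: local_unit.
by move=> [y xy]; apply/negP => xM; have := idealMr y xM; rewrite mulrC xy idealr1.
Qed.

Lemma local_lreg x : x \notin M -> GRing.lreg x.
Proof.
move/local_unit=> [y xy]; apply: mulrI0_lreg => z xz.
by rewrite -[z]mul1r -xy mulrAC xz mul0r.
Qed.

Lemma local_prime : prime_idealr_closed M.
Proof.
move=> u v uv; rewrite -[_ || _]negbK; apply/negP; rewrite negb_or.
move=> /andP[/local_unitP[u' uu'] /local_unitP[v' vv']].
move: uv; apply/negP/local_unitP; exists (u' * v').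
by rewrite mulrACA uu' vv' mulr1.
Qed.

(** An element [y] killed by all of [M] would make [M] its annihilator, that is,
an associated prime; so prime avoidance applies. *)
Lemma exists_lreg_in_M : ~ associated_prime M -> exists2 z, z \in M & GRing.lreg z.
Proof.
move=> Mass; have [noethT _ _] := T_local.
have [s [smax sreg]] := finite_max_ann noethT.
have [|z zM zs] := max_ann_avoidance (M := M) smax.
  move=> y y0; apply: contrapT => na; apply: Mass; split; first exact: local_prime.
  exists y => a; split=> [aM|ay].
    by apply: contrapT => ay; apply: na; exists a.
  by apply: contrapT => /negP/local_lreg/lreg_mul_neq0/(_ y0).
exists z => //; apply: contrapT => /sreg[y ys zy].
exact: zs zy.
Qed.

End Local.

(** * Power series in a regular element *)

Section IdealPowers.
Variables (R : comNzRingType) (I : idealr R).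
Local Notation pow := (ideal_pow [set` I]).

Lemma ideal_powS k a x : a \in I -> pow k x -> pow k.+1 (a * x).
Proof.
move=> aI xk; exists 1%N, (fun=> a), (fun=> x); split=> [//|].
by rewrite big_ord1.
Qed.

Lemma ideal_pow_exp k a : a \in I -> pow k (a ^+ k).
Proof. by move=> aI; elim: k => // k; rewrite exprS; exact: ideal_powS. Qed.

Lemma ideal_pow_le j k : (j <= k)%N -> pow k `<=` pow j.
Proof.
move=> /subnK <-; elim: (k - j)%N => // n IH x; rewrite addSn => -[m [a [b [hab ->]]]].
apply: IH; apply: ideal_sum => [|i _]; first exact: ideal_powP.
have [_ _ powM] := ideal_powP I (n + j); apply: powM.
by have [] := hab i.
Qed.

End IdealPowers.

Section Series.
Variables (T : comNzRingType) (M : idealr T).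
Hypotheses (T_local : is_local M) (T_complete : adic_complete M).
Variable z : T.
Hypotheses (zM : z \in M) (z_reg : GRing.lreg z).
Local Notation pow := (ideal_pow [set` M]).
Local Notation k := {ideal_quot M}.

Lemma pi_eq (a b : T) : (\pi_k a = \pi_k b)%qT <-> a - b \in M.
Proof. by rewrite Quotient.idealrBE; split=> /eqP. Qed.

(** [x u] is the sum of the series of the [u i * z ^+ i]. The functional equation
determines it and is all that is used of it. *)
Lemma exists_series : exists x : (nat -> T) -> T,
  forall u, x u = u 0%N + z * x (u \o S).
Proof.
pose part (u : nat -> T) n := \sum_(i < n) u i * z ^+ i.
have part_cauchy u i j : (i <= j)%N -> pow i (part u j - part u i).
  move=> /subnK <-; rewrite /part addnC big_split_ord /= addrAC subrr add0r.
  apply: ideal_sum => [|l _]; first exact: ideal_powP.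
  have [_ _ powM] := ideal_powP M i; rewrite exprD mulrCA [_ * (u _ * _)]mulrC; apply: powM.
  exact: ideal_pow_exp.
have partlim u : exists x, forall n, pow n (part u n - x).
  have [|x xlim] := T_complete.2 (part u).
    move=> n; exists n => i j ni nj; rewrite -[part u i](subrK (part u n)) -addrA.
    have idn := ideal_powP M n.
    have [_ powD _] := idn; apply: powD; first exact: part_cauchy.
    by rewrite -opprB; apply: (idealN idn); exact: part_cauchy.
  exists x => n; have [N /(_ (maxn N n) (leq_maxl _ _)) xN] := xlim n.
  have idn := ideal_powP M n; have [_ powD _] := idn.
  have -> : part u n - x = (part u n - part u (maxn N n)) + (part u (maxn N n) - x).
    by rewrite addrA subrK.
  apply: powD => //.
  by rewrite -opprB; apply: (idealN idn); apply: part_cauchy; exact: leq_maxr.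
have [x xlim] := choice partlim; exists x => u.
apply/eqP; rewrite -subr_eq0; apply/eqP; apply: T_complete.1 => n.
have idn := ideal_powP M n; have [_ powD powM] := idn.
have xS : pow n (x u - part u n.+1).
  by rewrite -opprB; apply: (idealN idn); apply: ideal_pow_le (xlim u n.+1).
have -> : x u - (u 0%N + z * x (u \o S)) =
    (x u - part u n.+1) + z * (part (u \o S) n - x (u \o S)).
  suff -> : part u n.+1 = u 0%N + z * part (u \o S) n by ring.
  rewrite /part big_ord_recl expr0 mulr1 mulr_sumr; congr (_ + _).
  by apply: eq_bigr => i _; rewrite mulrCA -exprS.
by apply: powD => //; apply: powM.
Qed.

(** If [i] is the first index where [u] and [v] differ, the difference of the two
sums is [z ^+ i] times a unit. *)
Lemma lreg_series (x : (nat -> T) -> T) u v n :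
  (forall u, x u = u 0%N + z * x (u \o S)) ->
  (forall i, u i = v i \/ u i - v i \notin M) -> u n <> v n ->
  GRing.lreg (x u - x v).
Proof.
move=> xE; elim: n u v => [|n IH] u v uv unv; have [uv0|uv0] := uv 0%N;
  try by case: (unv uv0).
2: have -> : x u - x v = z * (x (u \o S) - x (v \o S)) by rewrite (xE u) (xE v) uv0; ring.
2: by apply: lregM => //; apply: IH => // i; exact: uv.
all: apply: (local_lreg T_local); apply: contra uv0 => xM.
all: rewrite (_ : u 0%N - v 0%N = (x u - x v) - (x (u \o S) - x (v \o S)) * z);
  last (rewrite (xE u) (xE v); ring).
all: by rewrite rpredB // idealMr.
Qed.

Lemma exists_lreg_family : exists x : (nat -> k) -> T,
  forall u v, u <> v -> GRing.lreg (x u - x v).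
Proof.
have [x xE] := exists_series.
exists (fun u => x (fun i => repr (u i))) => u v uv.
have [n unv] : exists n, u n <> v n.
  by apply: contrapT => nn; apply: uv; apply/funext => n; apply: contrapT => unv; apply: nn; exists n.
have reprM a b : repr a - repr b \in M -> a = b :> k by move=> /pi_eq; rewrite !reprK.
apply: (@lreg_series _ _ _ n) => // [i|/(congr1 (\pi_k)%qT)]; last by rewrite !reprK.
have [/reprM ->|/negP h] := pselect (repr (u i) - repr (v i) \in M); last by right.
by left.
Qed.

(** Writing [t] as a representative of its residue plus a combination of the
generators of [M], and each coefficient likewise, attaches to [t] one residue
for every word in the generators; by separatedness these determine [t]. *)
Lemma embeds_digits : embeds T (nat -> k).
Proof.
have [noethT _ _] := T_local.
have [g Mg] := noethT _ (idealr_is_ideal M).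
have tcoef (t : T) : exists c : nat -> T,
    t - repr (\pi_k t)%qT = \sum_(i < size g) c i * g`_i.
  have : [set` M] (t - repr (\pi_k t)%qT) by apply/pi_eq; rewrite reprK.
  by rewrite Mg.
have {tcoef}[c cE] := choice tcoef.
have gM i : (i < size g)%N -> g`_i \in M.
  by move=> ig; have : ideal_span g g`_i by [apply/mem_ideal_span/mem_nth]; rewrite -Mg.
pose D (t : T) (w : seq nat) : k := (\pi_k (foldl c t w))%qT.
have Di n t t' : D t =1 D t' -> pow n (t - t').
  elim: n t t' => // n IH t t' Dt.
  have -> : t - t' = \sum_(i < size g) g`_i * (c t i - c t' i).
    have tE s : s = repr (D s [::]) + \sum_(i < size g) c s i * g`_i.
      by rewrite -cE addrC subrK.
    rewrite {1}(tE t) {1}(tE t') Dt opprD addrACA subrr add0r -sumrB.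
    by apply: eq_bigr => i _; rewrite -mulrBl mulrC.
  apply: ideal_sum => [|i _]; first exact: ideal_powP.
  by apply: ideal_powS; [exact: gM|apply: IH => w; exact: (Dt (_ :: w))].
exists (fun t n => D t (odflt [::] (choice.unpickle n))) => t t' tt'.
apply/eqP; rewrite -subr_eq0; apply/eqP; apply: T_complete.1 => n; apply: Di => w.
have : D t (odflt [::] (choice.unpickle (choice.pickle w))) = D t' (odflt [::] (choice.unpickle (choice.pickle w))).
  exact: (congr1 (fun f : nat -> k => f (choice.pickle w)) tt').
by rewrite choice.pickleK.
Qed.

Lemma exists_lreg_self_family : exists U : T -> T,
  forall t t', t <> t' -> GRing.lreg (U t - U t').
Proof.
have [x xreg] := exists_lreg_family; have [D Di] := embeds_digits.
by exists (x \o D) => t t' tt'; apply: xreg => /Di.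
Qed.

Lemma not_embeds_cantor : ~ embeds (nat -> bool) nat.
Proof.
move=> [i ii]; pose D n := ~~ `[< exists2 b, i b = n & b n >].
have [DD|/negP DD] := pselect (D (i D)).
  by have /negP := DD; apply; apply/asboolP; exists D.
by have /asboolP[b /ii bD] := negbNE DD; rewrite bD; exact/negP.
Qed.

(** The sums of the series with coefficients 0 and 1 are pairwise distinct. *)
Lemma complete_uncountable : ~ embeds T nat.
Proof.
have [x xreg] := exists_lreg_family => Tnat; apply: not_embeds_cantor.
apply: embeds_trans Tnat; exists (fun b => x (fun n => (b n)%:R)) => b b' xb.
apply/funext => n; apply: contrapT => bb'.
have /xreg/lreg_neq0 : (fun n => (b n)%:R : k) <> (fun n => (b' n)%:R).
  move=> /(congr1 (fun f : nat -> k => f n)) /=; case: (b n) (b' n) bb' => -[] //= _ /eqP.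
    by rewrite oner_eq0.
  by rewrite eq_sym oner_eq0.
by rewrite xb subrr eqxx.
Qed.

End Series.

(** * Generated subrings *)

(** Values of terms, written as finite trees whose nodes are labelled by
operations: the size of whatever a family generates is bounded by the number of
trees over it. *)
Fixpoint teval (X I : Type) (leaf : I -> X) (op : nat -> seq X -> X)
    (t : GenTree.tree I) : X :=
  match t with
  | GenTree.Leaf i => leaf i
  | GenTree.Node n l => op n [seq teval leaf op t | t <- l]
  end.

Section Subring.
Variable T : comNzRingType.
Implicit Types (G : set T) (s : seq T).

Inductive subring_gen G : T -> Prop :=
| subring_gen_base x : G x -> subring_gen G x
| subring_gen_1 : subring_gen G 1
| subring_gen_B x y : subring_gen G x -> subring_gen G y -> subring_gen G (x - y)
| subring_gen_M x y : subring_gen G x -> subring_gen G y -> subring_gen G (x * y).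

Definition sring G : {pred T} := fun x => `[< subring_gen G x >].

Lemma sring_closed G : subring_closed (sring G).
Proof.
split; first exact/asboolP/subring_gen_1.
- by move=> x y /asboolP Gx /asboolP Gy; exact/asboolP/subring_gen_B.
- by move=> x y /asboolP Gx /asboolP Gy; exact/asboolP/subring_gen_M.
Qed.

HB.instance Definition _ G :=
  GRing.isSubringClosed.Build T (sring G) (sring_closed G).

Lemma mem_sring G x : G x -> x \in sring G.
Proof. by move=> Gx; exact/asboolP/subring_gen_base. Qed.

Lemma sring_sub G (S : subringClosed T) : (forall x, G x -> x \in S) ->
  {subset sring G <= S}.
Proof.
move=> GS x /asboolP; elim => {x} [x /GS //||x y _ xS _ yS|x y _ xS _ yS].
- exact: rpred1.
- exact: rpredB.
- exact: rpredM.
Qed.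

Lemma sring_mono G G' : G `<=` G' -> {subset sring G <= sring G'}.
Proof. by move=> GG'; apply: sring_sub => x /GG'; exact: mem_sring. Qed.

Lemma sring_adjoinP G y x : x \in sring (G `|` [set y]) ->
  exists2 p : {poly T}, p \is a polyOver (sring G) & x = p.[y].
Proof.
move=> /asboolP; elim => {x} [x [Gx|->]||u v _ [p pG ->] _ [q qG ->]|u v _ [p pG ->] _ [q qG ->]].
- by exists x%:P; rewrite ?hornerC // polyOverC mem_sring.
- by exists 'X; rewrite ?hornerX // polyOverX.
- by exists 1; rewrite ?hornerC // rpred1.
- by exists (p - q); rewrite ?hornerD ?hornerN // rpredB.
- by exists (p * q); rewrite ?hornerM // rpredM.
Qed.

Definition ring_op n s : T :=
  match n with 0 => 1 | 1 => s`_0 - s`_1 | _ => s`_0 * s`_1 end.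

Lemma sring_teval G (I : Type) (g : I -> T) x :
  (forall x, G x -> exists i, g i = x) -> x \in sring G ->
  exists t, teval g ring_op t = x.
Proof.
move=> gG /asboolP; elim => {x} [x /gG[i <-]||x y _ [t <-] _ [t' <-]|x y _ [t <-] _ [t' <-]].
- by exists (GenTree.Leaf i).
- by exists (GenTree.Node 0 [::]).
- by exists (GenTree.Node 1 [:: t; t']).
- by exists (GenTree.Node 2 [:: t; t']).
Qed.

(** * Subrings without zero divisors of the ambient ring *)

Definition regular_on (A : {pred T}) :=
  forall x, x \in A -> x != 0 -> GRing.lreg x.

Definition transcendental G y :=
  forall p : {poly T}, p \is a polyOver (sring G) -> p != 0 -> GRing.lreg p.[y].

Lemma regular_adjoin_transcendental G y : transcendental G y ->
  regular_on (sring (G `|` [set y])).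
Proof.
move=> ytr x /sring_adjoinP[p pG ->] py0; apply: ytr => //.
by apply: contra py0 => /eqP->; rewrite horner0.
Qed.

(** [y] is the quotient of [a * y] by [a]. A power of [a] clears the
denominators of an element of the extended subring. *)
Lemma regular_adjoin_quotient G a y : regular_on (sring G) ->
  a \in sring G -> GRing.lreg a -> a * y \in sring G ->
  regular_on (sring (G `|` [set y])).
Proof.
move=> Greg aG areg ayG x /sring_adjoinP[p pG ->] py0.
have num : a ^+ size p * p.[y] \in sring G.
  rewrite horner_coef mulr_sumr; apply: rpred_sum => i _.
  have -> : a ^+ size p * (p`_i * y ^+ i) = a ^+ (size p - i) * p`_i * (a * y) ^+ i.
    have {1}-> : size p = (size p - i + i)%N by rewrite subnK // ltnW.
    by rewrite exprD exprMn; ring.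
  by rewrite !rpredM ?rpredX //; exact/polyOverP.
apply: (@GRing.lregMl _ (a ^+ size p)); apply: Greg => //.
by rewrite mulrI_eq0 //; exact: lregX.
Qed.

(** A nonzero polynomial over the domain [T / Ann y] has fewer roots than its
size; the proof splits off one linear factor at a time modulo [Ann y]. *)
Lemma max_ann_roots (y : T) (p : {poly T}) s : max_ann y ->
  (forall x, x \in s -> p.[x] * y = 0) -> uniq s ->
  (forall x x', x \in s -> x' \in s -> x != x' -> (x - x') * y <> 0) ->
  (size p <= size s)%N -> forall i, p`_i * y = 0.
Proof.
move=> ymax; elim: s p => [|a s IH] p roots.
  by move=> _ _; rewrite leqn0 size_poly_eq0 => /eqP-> i; rewrite coef0 mul0r.
move=> /= /andP[nas us] sep size_p.
have /factor_theorem[q pq] : root (p - p.[a]%:P) a.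
  by rewrite rootE !hornerE subrr.
have {pq} pE : p = q * ('X - a%:P) + p.[a]%:P by rewrite -pq subrK.
have pay : p.[a] * y = 0 by apply: roots; rewrite inE eqxx.
have qy i : q`_i * y = 0.
  apply: IH => // [x xs|x x' xs x's|].
  - have xa : x != a by apply: contraNneq nas => <-.
    have : q.[x] * (x - a) * y = 0.
      have := roots x; rewrite inE xs orbT => /(_ isT).
      by rewrite {1}pE !hornerE mulrDl pay addr0.
    by move=> /(max_ann_prime ymax)[//|]; apply: contraPP => _; apply: sep => //; rewrite inE ?eqxx ?xs ?orbT.
  - by apply: sep; rewrite inE ?xs ?x's orbT.
  - have [->|q0] := eqVneq q 0; first by rewrite size_poly0.
    have : (size (q * ('X - a%:P))%R <= size s + 1)%N.
      have -> : q * ('X - a%:P) = p - p.[a]%:P by rewrite {1}pE addrK.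
      apply: leq_trans (size_polyD _ _) _; rewrite size_polyN geq_max addn1 size_p.
      exact: leq_trans (size_polyC_leq1 _) _.
    by rewrite size_Mmonic ?monicXsubC // size_XsubC addn2 /= addn1 ltnS.
move=> i; rewrite pE coefD coefC mulrDl mulrBr coefB coefMX coefMC.
rewrite mulrBl mulrAC qy mul0r subr0.
have -> : (if (i == 0)%N then 0 else q`_i.-1) * y = 0.
  by case: ifP => _; rewrite ?mul0r ?qy.
by case: ifP => _; rewrite ?mul0r ?pay addr0.
Qed.

End Subring.

(** * Adjoining generic elements *)

Section Generic.
Variable T : comNzRingType.
Implicit Types (G : set T) (s : seq T).

(** Smaller than [T], in a form that also rules out a countable [T]: the summand
[nat] makes the index type infinite, so that it absorbs the polynomials over
the generated subring. *)
Definition small G := exists (I : Type) (g : I -> T),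
  (forall x, G x -> exists i, g i = x) /\ ~ embeds T (I + nat).

Lemma embeds_nat_sum (I : Type) : embeds nat (I + nat).
Proof. by exists inr => m n []. Qed.

Lemma embeds_inl (I J : Type) : embeds I (I + J).
Proof. by exists inl => m n []. Qed.

Lemma small_adjoin G y : small G -> small (G `|` [set y]).
Proof.
move=> [I [g [gG nT]]]; exists (option I), (oapp g y); split.
  by move=> x [/gG[i <-]|->]; [exists (Some i)|exists None].
move=> TI; apply: nT; apply: embeds_trans TI _.
apply: embeds_sum_le; [exact: embeds_nat_sum| |exact: embeds_nat_sum].
by exists (fun o => if o is Some i then inl i else inr 0%N) => -[i|] [j|] // [->].
Qed.

Hypothesis noethT : noetherian T.
Variable U : T -> T.
Hypothesis U_reg : forall t t', t <> t' -> GRing.lreg (U t - U t').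

(** Each nonzero polynomial over the generated subring takes zero-divisor values at
only finitely many of the points [t + a * U u], since these stay distinct
modulo each of the finitely many maximal associated primes. The polynomials
are too few to exclude every [u]. *)
Lemma exists_transcendental G t a : small G -> regular_on (sring G) ->
  GRing.lreg a -> exists x, transcendental G (t + a * x).
Proof.
move=> [I [g [gG nT]]] Greg areg; apply: contrapT => nx.
have [Y [Ymax Yzd]] := finite_max_ann noethT.
have bad u : exists py : {poly T} * T, [/\ py.1 \is a polyOver (sring G),
    py.1 != 0, py.2 \in Y & py.1.[t + a * U u] * py.2 = 0].
  apply: contrapT => nb; apply: nx; exists (U u) => p pG p0.
  apply: contrapT => /Yzd[y yY py0]; apply: nb.
  by exists (p, y).
have [py pyP] := choice bad.
(* [fib q] collects the [u] excluded by the polynomial [q.1] and the prime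
   [Ann q.2]. *)
pose fib q := [set u | py u = q].
have fib_fin q : finite_set (fib q).
  apply: contrapT => fib_inf; have [u0 u0q] := infinite_setN0 fib_inf.
  have [B Bfib sizeB] := infinite_set_fset (size q.1) fib_inf.
  have Bq u : u \in B -> py u = q by move=> /Bfib.
  have [qG q0 qY _] := pyP u0; rewrite u0q in qG q0 qY.
  have [qy0 _] := Ymax _ qY.
  suff /(_ (size q.1).-1) : forall i, q.1`_i * q.2 = 0.
    apply: lreg_mul_neq0 => //; apply: Greg; first exact/polyOverP.
    by rewrite -lead_coefE lead_coef_eq0.
  apply: (@max_ann_roots _ q.2 q.1 [seq t + a * U u | u <- B] (Ymax _ qY)).
  - by move=> x /mapP[u /Bq qu ->]; have [_ _ _] := pyP u; rewrite qu.
  - rewrite map_inj_in_uniq ?fset_uniq // => u v _ _ /addrI/areg Uuv.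
    apply: contrapT => uv; have /lreg_neq0 := U_reg uv.
    by rewrite Uuv subrr eqxx.
  - move=> x x' /mapP[u _ ->] /mapP[v _ ->] uv.
    rewrite opprD addrACA subrr add0r -mulrBr; apply: lreg_mul_neq0 => //.
    by apply: lregM => //; apply: U_reg => uv'; rewrite uv' eqxx in uv.
  - by rewrite size_map.
have /choice[rk rkP] q : exists f : T -> nat, {in fib q &, injective f}.
  by apply/countable_injP/finite_set_countable.
have /choice[e eP] x : exists w, x \in sring G -> teval g (@ring_op T) w = x.
  have [xG|nxG] := pselect (x \in sring G); last by exists (GenTree.Node 0 [::]).
  by have [w wx] := sring_teval gG xG; exists w.
apply: nT; have natI := embeds_nat_sum I.
apply: (@embeds_trans (seq (GenTree.tree I) * (nat * nat))); last first.
  apply: embeds_prod_le => //; last exact: embeds_prod_le.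
  apply: embeds_seq_le => //; apply: embeds_tree_le => //; exact: embeds_inl.
(* [u] is recovered from the polynomial and the prime that exclude it, together
   with its rank among the finitely many points they exclude. *)
exists (fun u => (map e (polyseq (py u).1), (index (py u).2 Y, rk (py u) u))).
move=> u v [euv iuv ruv].
have [uG _ uY _] := pyP u; have [vG _ vY _] := pyP v.
have puv : py u = py v.
  apply: injective_projections; last first.
    by rewrite -[LHS](nth_index 0 uY) iuv nth_index.
  apply/val_inj => /=; have := congr1 (map (teval g (@ring_op T))) euv.
  rewrite -!map_comp !map_id_in // => x; rewrite -?[x \in (py _).1]/(x \in polyseq _).
    by move=> /(nthP 0)[i _ <-]; apply: eP; exact/polyOverP.
  by move=> /(nthP 0)[i _ <-]; apply: eP; exact/polyOverP.
apply: (rkP (py u)); [exact: mem_set|exact/mem_set/esym|by rewrite ruv puv].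
Qed.

(** * Solving a linear equation inside the subring *)

Definition span_in (A : {pred T}) s (x : T) := exists b : nat -> T,
  (forall i, b i \in A) /\ x = \sum_(i < size s) b i * s`_i.

Definition closed_span (A : {pred T}) := forall s c,
  (forall x, x \in s -> x \in A) -> c \in A -> ideal_span s c -> span_in A s c.

Lemma span_in_nil (A : subringClosed T) : span_in A [::] 0.
Proof. by exists (fun=> 0); split=> [i|]; rewrite ?rpred0 // big_ord0. Qed.

Lemma span_in_cons (A : {pred T}) a s b x :
  b \in A -> span_in A s x -> span_in A (a :: s) (b * a + x).
Proof.
move=> bA [c [cA ->]]; exists (fun i => if i is i'.+1 then c i' else b).
by split=> [[]//|]; rewrite /= big_ord_recl.
Qed.

Lemma setU1_cons G y s : (G `|` [set y]) `|` [set` s] = G `|` [set` y :: s].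
Proof.
apply/seteqP; split=> x /=.
  by case=> [[Gx|->]|xs]; [left|right; rewrite inE eqxx|right; rewrite inE xs orbT].
by case=> [Gx|]; [left; left|rewrite inE => /orP[/eqP->|xs]; [left; right|right]].
Qed.

(** With two or more generators the first coefficient may be moved by any
multiple of the second generator, hence made generic and adjoined, which leaves
an equation with one generator fewer. The last coefficient is then a quotient of
elements already present. *)
Lemma solve_membership G s c : small G -> regular_on (sring G) ->
  (forall x, x \in s -> x \in sring G) -> c \in sring G -> ideal_span s c ->
  exists ys : seq T, regular_on (sring (G `|` [set` ys])) /\
    span_in (sring (G `|` [set` ys])) s c.
Proof.
have [n] := ubnP (size s); elim: n s G c => // n IH s G c + smallG Greg.
have U0 : G `|` [set` [::]] = G by apply/seteqP; split=> x; [case|left].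
case: s => [|a1 [|a2 s]] size_s sG cG.
- move=> [d]; rewrite big_ord0 => ->; exists [::]; rewrite U0; split=> //.
  exact: span_in_nil.
- move=> /ideal_span_consP[t [_ [[d ->] cE]]]; rewrite big_ord0 addr0 in cE.
  have a1G := sG a1 (mem_head _ _).
  have span1 (ys : seq T) b : b \in sring (G `|` [set` ys]) -> c = b * a1 ->
      span_in (sring (G `|` [set` ys])) [:: a1] c.
    by move=> /span_in_cons-/(_ a1 [::] 0 (span_in_nil _)); rewrite addr0 => + ->.
  have [a0|/(Greg _ a1G) a1reg] := eqVneq a1 0.
    exists [::]; split; first by rewrite U0.
    by apply: (span1 [::] 0); rewrite ?rpred0 // cE a0 !mulr0.
  exists [:: t]; rewrite -{1}setU1_cons; split; last first.
    by apply: (span1 _ t) => //; apply: mem_sring; right; exact: mem_head.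
  rewrite (_ : _ `|` [set` [::]] = G `|` [set t]); last by apply/seteqP; split=> x; [case|left].
  by apply: regular_adjoin_quotient a1G a1reg _ => //; rewrite mulrC -cE.
- move=> /ideal_span_consP[t1 [_ [/ideal_span_consP[t2 [v [vs ->]]] cE]]].
  have a1G : a1 \in sring G by apply: sG; rewrite inE eqxx.
  have a2G : a2 \in sring G by apply: sG; rewrite !inE eqxx orbT.
  have s'G x : x \in s -> x \in sring G by move=> xs; apply: sG; rewrite !inE xs !orbT.
  have [a0|/(Greg _ a2G) a2reg] := eqVneq a2 0.
    have [| | |ys [ysreg [b [bG bE]]]] := IH (a1 :: s) G c _ smallG Greg _ cG.
    + by rewrite -ltnS; exact: leq_trans size_s.
    + by move=> x; rewrite inE => /orP[/eqP->//|/s'G].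
    + by apply/ideal_span_consP; exists t1, v; split=> //; rewrite cE a0 mulr0 add0r.
    exists ys; split=> //; rewrite bE big_ord_recl /=.
    apply: span_in_cons => //; rewrite -[X in span_in _ _ X]add0r -[X in X + _](mul0r a2).
    apply: span_in_cons; first exact: rpred0.
    by exists (b \o S); split=> [i|]; [exact: bG|apply: eq_bigr].
  have [x ytr] := exists_transcendental t1 smallG Greg a2reg.
  set y := t1 + a2 * x in ytr.
  have GG' : {subset sring G <= sring (G `|` [set y])} by apply: sring_mono => w; left.
  have yG : y \in sring (G `|` [set y]) by apply: mem_sring; right.
  have [| | | |ys [ysreg ys_span]] := IH (a2 :: s) (G `|` [set y]) (c - y * a1) _ (small_adjoin _ smallG)
    (regular_adjoin_transcendental ytr).
  + by rewrite -ltnS; exact: leq_trans size_s.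
  + by move=> w; rewrite inE => /orP[/eqP->|/s'G]; exact: GG'.
  + by apply: rpredB; [exact: GG'|apply: rpredM => //; exact: GG'].
  + apply/ideal_span_consP; exists (t2 - a1 * x), v; split=> //.
    by rewrite cE /y; ring.
  exists (y :: ys); rewrite -setU1_cons; split=> //.
  rewrite -[c](subrK (y * a1)) addrC; apply: span_in_cons => //.
  by apply: sring_mono yG => w; left.
Qed.

End Generic.

(** * The transfinite construction *)

Lemma sring0_int (T : comNzRingType) (x : T) : x \in sring set0 -> exists n : int, x = n%:~R.
Proof.
move=> /asboolP; elim => {x} [//||x y _ [m ->] _ [n ->]|x y _ [m ->] _ [n ->]].
- by exists 1.
- by exists (m - n); rewrite rmorphB.
- by exists (m * n); rewrite rmorphM.
Qed.

Section Construction.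
Variable T : comNzRingType.
Hypothesis noethT : noetherian T.
Variable U : T -> T.
Hypothesis U_reg : forall t t', t <> t' -> GRing.lreg (U t - U t').
Hypothesis T_uncountable : ~ embeds T nat.
Hypothesis int_reg : regular_on (@sring T set0).
Variable d : T.
Hypothesis d_reg : GRing.lreg d.

(** The task [q] asks for a representative of [q.1] modulo [d * T] and for the
equation that expresses [q.1] through the entries of [q.2]; the latter demand
is empty as long as these elements are not in the subring. *)
Definition good_step (G : set T) (q : T * seq T) (ys : seq T) :=
  [/\ regular_on (sring (G `|` [set` ys])),
      exists x, q.1 + d * x \in sring (G `|` [set` ys]) &
      (forall x, x \in q.2 -> x \in sring G) -> q.1 \in sring G ->
      ideal_span q.2 q.1 -> span_in (sring (G `|` [set` ys])) q.2 q.1].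

Lemma exists_good_step G q : small G -> regular_on (sring G) ->
  exists ys, good_step G q ys.
Proof.
move: q => [c s] smallG Greg.
have [x ytr] := exists_transcendental noethT U_reg c smallG Greg d_reg.
set y := c + d * x in ytr.
have y1reg := regular_adjoin_transcendental ytr.
have Gy : G `|` [set y] = G `|` [set` [:: y]].
  by apply/seteqP; split=> u /=; rewrite ?inE => -[Gu|]; [left|move=> ->; right|left|move=> /eqP->; right]; rewrite ?inE.
have yG ys : y \in sring ((G `|` [set y]) `|` [set` (ys : seq T)]).
  by apply: mem_sring; left; right.
have [[sG cG sc]|ns] := pselect [/\ (forall x, x \in s -> x \in sring G), c \in sring G & ideal_span s c].
  have GG' : {subset sring G <= sring (G `|` [set y])} by apply: sring_mono => w; left.
  have [||ys [ysreg ysc]] := solve_membership noethT U_reg (small_adjoin y smallG) y1reg _ _ sc.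
  - by move=> u /sG/GG'.
  - exact: GG'.
  by exists (y :: ys); rewrite /good_step -setU1_cons; split=> //; exists x; exact: yG.
exists [:: y]; rewrite /good_step -Gy; split=> //=.
- by exists x; apply: mem_sring; right.
- by move=> *; case: ns.
Qed.

Lemma embeds_nat_T : embeds nat T.
Proof. by apply: contrapT => /finite_embeds_nat. Qed.

Variable lt : T -> T -> Prop.
Hypotheses (lt_wo : strict_wo lt) (lt_initial : forall t, ~ embeds T (seg lt t)).

Lemma seg_small t : ~ embeds T (seg lt t + nat).
Proof.
move=> Tt; have [natt|/finite_embeds_nat tnat] := pselect (embeds nat (seg lt t)).
  by apply: (lt_initial (t := t)); apply: embeds_trans Tt (embeds_sum_le natt (embeds_refl _) natt).
apply: T_uncountable; apply: embeds_trans Tt _.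
exact: (embeds_sum_le (embeds_refl nat) tnat (embeds_refl nat)).
Qed.

(** Bookkeeping: as [T] has as many elements as there are pairs of a task and
an element of [T], each task can be assigned to as many stages as [T] has
elements, and hence to arbitrarily late ones. *)
Lemma exists_schedule : exists task : T -> T * seq T,
  forall q t, exists2 s, lt t s & task s = q.
Proof.
have natT := embeds_nat_T.
have [e ei] : embeds ((T * seq T) * T) T.
  apply: embeds_prod_le (embeds_refl _) => //.
  apply: embeds_prod_le (embeds_refl _) _ => //.
  exact: embeds_seq_le (embeds_refl _).
have /choice[task taskP] s : exists q, forall p, e p = s -> p.1 = q.
  have [[p <-]|np] := pselect (exists p, e p = s); last first.
    by exists (0, [::]) => p ps; case: np; exists p.
  by exists p.1 => p' /ei ->.
exists task => q t; apply: contrapT => nlt; apply: (seg_small (t := t)).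
have le_t x : e (q, x) = t \/ lt (e (q, x)) t.
  have [->|h|h] := wo_total lt_wo (e (q, x)) t; [by left|by right|].
  by case: nlt; exists (e (q, x)) => //; rewrite -(taskP _ _ erefl).
apply: (@embeds_trans {x | x = t \/ lt x t}).
  by exists (fun x => exist _ (e (q, x)) (le_t x)) => x y [/ei[]].
apply: embeds_trans (embeds_closed_seg lt t) _.
by exists (fun o => if o is Some i then inl i else inr 0%N) => -[i|] [j|] // [->].
Qed.

Variable task : T -> T * seq T.
Hypothesis task_cofinal : forall q t, exists2 s, lt t s & task s = q.

(** Each stage sees the union of the earlier lists and picks a list that carries
out its task, if there is one. *)
Lemma exists_stages : exists f : T -> seq T, forall s,
  let G := [set x | exists2 r, lt r s & x \in f r] in
  (exists ys, good_step G (task s) ys) -> good_step G (task s) (f s).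
Proof.
pose F s (rec : forall r, lt r s -> seq T) : seq T :=
  xget [::] [set ys | good_step [set x | exists r (rs : lt r s), x \in rec r rs] (task s) ys].
pose f := Fix (wo_wf lt_wo) (fun=> seq T) F.
exists f => s G [ys ysP].
have -> : f s = F s (fun r _ => f r).
  rewrite /f Fix_eq // => {s G ys ysP} s g h gh; rewrite /F.
  suff -> : [set x | exists r (rs : lt r s), x \in g r rs] =
            [set x | exists r (rs : lt r s), x \in h r rs] by [].
  by apply/seteqP; split=> x [r [rs xr]]; exists r, rs; [rewrite -gh|rewrite gh].
rewrite /F (_ : [set x | _] = G); last first.
  by apply/seteqP; split=> x; [move=> [r [rs xr]]; exists r|move=> [r rs xr]; exists r, rs].
by case: xgetP => [ys' _ //|/(_ ys)].
Qed.

Variable f : T -> seq T.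
Let below s := [set x | exists2 r, lt r s & x \in f r].
Hypothesis f_good : forall s,
  (exists ys, good_step (below s) (task s) ys) -> good_step (below s) (task s) (f s).
(** [None] stands for the prime subring, from which the construction starts. *)
Let stage (o : option T) : set T :=
  if o is Some s then below s `|` [set` f s] else set0.

Lemma stage_below r s : lt r s -> stage (Some r) `<=` below s.
Proof.
move=> rs x [[q qr xq]|xr]; last by exists r.
by exists q => //; exact: (wo_trans lt_wo qr rs).
Qed.

Lemma stage_directed (D : set T) o o' :
  (forall s, o = Some s -> D s) -> (forall s, o' = Some s -> D s) ->
  exists2 o'', (forall s, o'' = Some s -> D s) &
    stage o `<=` stage o'' /\ stage o' `<=` stage o''.
Proof.
case: o o' => [r|] [r'|] Dr Dr'; last by exists None; [|split].
- have [rr'|rr'|rr'] := wo_total lt_wo r r'.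
  + by exists (Some r'); [|rewrite rr'; split].
  + by exists (Some r') => //; split=> // x /(stage_below rr'); left.
  + by exists (Some r) => //; split=> // x /(stage_below rr'); left.
- by exists (Some r); [|split].
- by exists (Some r'); [|split].
Qed.

(** The subring generated by a union of stages is the union of the subrings they
generate, since the stages form a chain. *)
Lemma mem_stage (D : set T) x : x \in sring [set x | exists2 r, D r & x \in f r] ->
  exists2 o, (forall s, o = Some s -> D s) & x \in sring (stage o).
Proof.
have join u v o o' : (forall s, o = Some s -> D s) -> (forall s, o' = Some s -> D s) ->
    u \in sring (stage o) -> v \in sring (stage o') ->
    exists2 o'', (forall s, o'' = Some s -> D s) &
      u \in sring (stage o'') /\ v \in sring (stage o'').
  move=> oD o'D uo vo'; have [o'' o''D [oo o'o]] := stage_directed oD o'D.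
  by exists o'' => //; split; [exact: sring_mono oo _ uo|exact: sring_mono o'o _ vo'].
move=> /asboolP; elim => {x} [x [r Dr xr]||x y _ [o oD xo] _ [o' o'D yo']|x y _ [o oD xo] _ [o' o'D yo']].
- by exists (Some r) => [_ [<-] //|]; apply: mem_sring; right.
- by exists None => //; exact: rpred1.
- by have [o'' o''D [xo'' yo'']] := join _ _ _ _ oD o'D xo yo'; exists o'' => //; exact: rpredB.
- by have [o'' o''D [xo'' yo'']] := join _ _ _ _ oD o'D xo yo'; exists o'' => //; exact: rpredM.
Qed.

Lemma small_below s : small (below s).
Proof.
exists (seg lt s * nat)%type, (fun p => nth 0 (f (sval p.1)) p.2); split.
  move=> x [r rs xr]; exists (exist (lt^~ s) r rs, index x (f r)).
  by rewrite /= nth_index.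
move=> Ts; apply: (seg_small (t := s)); apply: embeds_trans Ts _.
have natI := embeds_nat_sum (seg lt s).
by apply: embeds_sum_le => //; apply: embeds_prod_le => //; exact: embeds_inl.
Qed.

Lemma regular_below s : regular_on (sring (below s)).
Proof.
elim: s / (wo_wf lt_wo s) => s _ IH x /(mem_stage (D := lt^~ s))[[r|] rs xr] x0.
  have [+ _ _] : good_step (below r) (task r) (f r).
    by apply: f_good; apply: exists_good_step; [exact: small_below|apply/IH/rs].
  exact.
exact: int_reg xr x0.
Qed.

Lemma stage_good s : good_step (below s) (task s) (f s).
Proof. by apply/f_good/exists_good_step; [exact: small_below|exact: regular_below]. Qed.

Let G := [set x | exists2 r, [set: T] r & x \in f r].

Lemma stage_sub o : stage o `<=` G.
Proof. by case: o => // s x [[r _ xr]|xs]; [exists r|exists s]. Qed.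

Lemma regular_union : regular_on (sring G).
Proof.
move=> x /mem_stage[[r|] _ xr]; last exact: int_reg.
by have [+ _ _] := stage_good r; exact.
Qed.

Lemma union_surj t : exists x, t + d * x \in sring G.
Proof.
have [s _ sE] := task_cofinal (t, [::]) t.
have [_ [x xs] _] := stage_good s; exists x.
by rewrite sE in xs; exact: sring_mono (stage_sub (o := Some s)) _ xs.
Qed.

(** The finitely many elements involved appear at some stage; the equation is a
task of a later one, which solves it. *)
Lemma union_closed_span : closed_span (sring G).
Proof.
move=> s c sG cG sc.
have [r [sr cr]] : exists r, (forall x, x \in s -> x \in sring (stage r)) /\
    c \in sring (stage r).
  elim: s sG {sc} => [|x s IH] sG; first by have [o _ co] := mem_stage cG; exists o.
  have [|r [sr cr]] := IH; first by move=> y ys; apply: sG; rewrite inE ys orbT.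
  have [o _ xo] := mem_stage (sG x (mem_head _ _)).
  have [//|//|o' _ [ro' oo']] := @stage_directed setT r o.
  exists o'; split; last exact: sring_mono ro' _ cr.
  move=> y; rewrite inE => /orP[/eqP->|/sr yr]; first exact: sring_mono oo' _ xo.
  exact: sring_mono ro' _ yr.
have [t rt] : exists t, stage r `<=` below t.
  case: r {sr cr} => [r|]; last by exists 0.
  have [t rt _] := task_cofinal (0, [::]) r.
  by exists t; exact: stage_below.
have [u tu uE] := task_cofinal (c, s) t.
have ru : stage r `<=` below u.
  by move=> x /rt xt; apply: (stage_below tu); left.
have [_ _] := stage_good u; rewrite uE /= => -[||//|b [bu cE]].
- by move=> x /sr; exact: sring_mono.
- exact: sring_mono ru _ cr.
exists b; split=> // i.
exact: sring_mono (stage_sub (o := Some u)) _ (bu i).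
Qed.

End Construction.

Lemma exists_regular_closed (T : comNzRingType) (U : T -> T) (d : T) :
  noetherian T -> (forall t t', t <> t' -> GRing.lreg (U t - U t')) ->
  ~ embeds T nat -> regular_on (@sring T set0) -> GRing.lreg d ->
  exists G : set T, [/\ regular_on (sring G),
    forall t, exists x, t + d * x \in sring G & closed_span (sring G)].
Proof.
move=> noethT Ureg Tunc int_reg dreg.
have [lt [ltwo ltini]] := exists_initial_wo T.
have [task taskP] := exists_schedule Tunc ltwo ltini.
have [f fP] := exists_stages d ltwo task.
exists [set x | exists2 r, [set: T] r & x \in f r]; split.
- exact: (regular_union noethT Ureg Tunc int_reg dreg ltwo ltini fP).
- exact: (union_surj noethT Ureg Tunc int_reg dreg ltwo ltini taskP fP).
- exact: (union_closed_span noethT Ureg Tunc int_reg dreg ltwo ltini taskP fP).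
Qed.

(** * Subrings that determine the completion *)

Section Completing.
Variables (T : comNzRingType) (M : idealr T).
Local Notation k := {ideal_quot M}.

Record completing (A : {pred T}) : Prop := Completing {
  completing_subring : subring_closed A;
  completing_regular : regular_on A;
  completing_residue : forall x, exists2 a, a \in A & x - a \in M;
  completing_gens : exists s : seq T,
    (forall x, x \in s -> x \in A /\ x \in M) /\ [set` M] `<=` ideal_span s;
  completing_span : closed_span A }.

Hypotheses (T_local : is_local M) (T_complete : adic_complete M).
Hypothesis T_int : forall n : int, n%:~R != 0 :> T -> ~ zero_divisor (n%:~R : T).

Lemma completing_field : [set` M] = [set 0] -> completing (@predT T).
Proof.
move=> M0; have inM x : x \in M -> x = 0 by move=> xM; have : [set` M] x by []; rewrite M0.
split=> //.
- move=> x _ x0; apply: (local_lreg T_local).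
  by apply: contra x0 => /inM ->.
- by move=> x; exists x => //; rewrite subrr idealr0.
- by exists [::]; split=> // x; rewrite M0 => ->; exists (fun=> 0); rewrite big_ord0.
- by move=> s c _ _ [b ->]; exists b.
Qed.

(** The point is that the elements of [M] in the subring generate [M]. One of
them is [z * (1 + z * y)] for some [y], and [1 + z * y] is a unit, so the ideal
they generate contains [z]; as the subring meets every class modulo [z ^+ 2],
that ideal is all of [M]. *)
Lemma completing_sring G z : z \in M -> regular_on (sring G) ->
  (forall t, exists x, t + z * z * x \in sring G) ->
  closed_span (sring G) -> completing (sring G).
Proof.
move=> zM Greg Gsurj Gspan; split=> //; first exact: sring_closed.
- move=> t; have [x xG] := Gsurj t; exists (t + z * z * x) => //.
  by rewrite opprD addNKr -mulNr mulrC idealMr // -mulrN mulrC idealMr // rpredN.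
have [noethT _ _] := T_local.
have [s [sB Bs]] := noetherian_finite_subset noethT [set x | x \in sring G /\ x \in M].
exists s; split=> // x xM.
have span_id := is_ideal_span s; have [_ spanD spanM] := span_id.
have shift t : t \in M -> exists y, ideal_span s (t + z * z * y).
  move=> tM; have [y yG] := Gsurj t; exists y; apply: Bs; split=> //.
  by rewrite rpredD // mulrC idealMr // idealMr.
have zs : ideal_span s z.
  have [y] := shift z zM.
  have [|u uE] := local_unit T_local (x := 1 + z * y).
    apply/negP => h; have := rpredB h (idealMr y zM).
    by rewrite [y * z]mulrC addrK idealr1.
  move=> /(spanM u); congr (ideal_span s _).
  by rewrite -[RHS]mulr1 -uE; ring.
have [y ys] := shift x xM.
have -> : x = (x + z * z * y) - (z * y) * z by ring.
by apply: (idealB span_id) => //; exact: spanM.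
Qed.

Lemma exists_completing :
  ([set` M] <> [set 0] -> ~ associated_prime M) -> exists A, completing A.
Proof.
move=> Mass; have [M0|M0] := pselect ([set` M] = [set 0]).
  by exists (pred_of_simpl (@predT T)); exact: completing_field.
have [z zM zreg] := exists_lreg_in_M T_local (Mass M0).
have [noethT _ _] := T_local.
have [U Ureg] := exists_lreg_self_family T_local T_complete zM zreg.
have Tunc := complete_uncountable T_local T_complete zM zreg.
have int_reg : regular_on (@sring T set0).
  move=> x /sring0_int[n ->] n0; apply: mulrI0_lreg => y ny.
  by apply: contrapT => /eqP y0; apply: (T_int n0); exists y.
have [G [Greg Gsurj Gspan]] := exists_regular_closed noethT Ureg Tunc int_reg (lregM zreg zreg).
by exists (sring G); exact: completing_sring zM Greg Gsurj Gspan.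
Qed.

(** Downward Loewenheim-Skolem: close representatives of the residue field
and generators of [M] under the ring operations and under solving linear
equations. The elements obtained are values of finite trees with leaves in
[k]. *)
Lemma completing_shrink A : completing A ->
  exists2 H, completing H & embeds {x | x \in H} (GenTree.tree k).
Proof.
move=> [Asub Areg Ares [ms [msA Mms]] Aspan].
have [A1 AB AM] := Asub.
have /choice[sg sgP] (r : k) : exists a, a \in A /\ (\pi_k a)%qT = r.
  have [a aA ra] := Ares (repr r); exists a; split=> //.
  by rewrite -[RHS]reprK; apply/esym/pi_eq.
have /choice[W WP] (p : T * seq T) : exists b : nat -> T, (forall i, b i \in A) /\
    ((forall x, x \in p.2 -> x \in A) -> p.1 \in A -> ideal_span p.2 p.1 ->
     p.1 = \sum_(i < size p.2) b i * p.2`_i).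
  have [[h1 h2 h3]|nh] := pselect [/\ forall x, x \in p.2 -> x \in A, p.1 \in A & ideal_span p.2 p.1].
    by have [b [bA bE]] := Aspan _ _ h1 h2 h3; exists b.
  by exists (fun=> 1); split=> // h1 h2 h3; case: nh.
(* The operations 0, 1 and 2 are those of the ring. The others have as values, on
   the empty list, the generators of [M] and, on [c :: s], the coefficients of an
   expression of [c] through [s]. *)
pose op n (vs : seq T) : T := match n with
  | 0 => 1 | 1 => vs`_0 - vs`_1 | 2 => vs`_0 * vs`_1
  | n.+3 => if vs is c :: s then W (c, s) n else ms`_n end.
have A0 : 0 \in A by rewrite -(subrr 1) AB.
have nthA s i : (forall x, x \in s -> x \in A) -> s`_i \in A.
  move=> sA; have [lt_i|le_i] := ltnP i (size s); first exact/sA/mem_nth.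
  by rewrite nth_default.
have opA n vs : (forall x, x \in vs -> x \in A) -> op n vs \in A.
  move=> vsA; case: n => [|[|[|n]]] /=; [exact: A1|by apply: AB; exact: nthA|by apply: AM; exact: nthA|].
  case: vs vsA => [_|c s _]; last exact: (WP (c, s)).1.
  by apply: nthA => x /msA[].
have evalA t : teval sg op t \in A.
  elim: t => [r|n l IH] /=; first exact: (sgP r).1.
  apply: opA; elim: l IH => // t l IHl /= [tA /IHl lA] x.
  by rewrite inE => /orP[/eqP->|/lA].
pose H : {pred T} := fun x => `[< exists t, teval sg op t = x >].
have inH t : teval sg op t \in H by apply/asboolP; exists t.
have HA x : x \in H -> x \in A by move=> /asboolP[t <-].
have Hlist s : (forall x, x \in s -> x \in H) -> exists l, map (teval sg op) l = s.
  elim: s => [|x s IH] sH; first by exists [::].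
  have [|l <-] := IH; first by move=> y ys; apply: sH; rewrite inE ys orbT.
  by have /asboolP[t <-] := sH x (mem_head _ _); exists (t :: l).
exists H; last first.
  have /choice[e eP] : forall x : {x | x \in H}, exists t, teval sg op t = sval x.
    by move=> [x xH]; have /asboolP[t tx] := xH; exists t.
  by exists e => x y exy; apply: sval_inj; rewrite -(eP x) -(eP y) exy.
split.
- split; first exact: (inH (GenTree.Node 0 [::])).
  + by move=> _ _ /asboolP[t <-] /asboolP[u <-]; exact: (inH (GenTree.Node 1 [:: t; u])).
  + by move=> _ _ /asboolP[t <-] /asboolP[u <-]; exact: (inH (GenTree.Node 2 [:: t; u])).
- by move=> x /HA; exact: Areg.
- move=> x; exists (sg (\pi_k x)%qT); first exact: (inH (GenTree.Leaf (\pi_k x)%qT)).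
  by apply/pi_eq; rewrite (sgP _).2.
- exists ms; split=> // x xms; split; last by have [] := msA x xms.
  by have := inH (GenTree.Node (index x ms).+3 [::]); rewrite /= nth_index.
- move=> s c sH cH sc; exists (W (c, s)); split; last first.
    by apply: (WP (c, s)).2 => // [x /sH|]; exact: HA.
  move=> i; have [l ls] := Hlist s sH; have /asboolP[t tc] := cH.
  by have := inH (GenTree.Node i.+3 (t :: l)); rewrite /= tc ls.
Qed.

End Completing.

(** * The subring as a local domain *)

Section Elements.
Variables (T : comNzRingType) (M : idealr T).

(** Bundling the predicate with its properties lets the ring structure of [elt]
below be inferred. *)
Record completing_pred := CompletingPred {
  cpred :> {pred T};
  cpredP : completing M cpred }.

HB.instance Definition _ (A : completing_pred) :=
  GRing.isSubringClosed.Build T (cpred A) (completing_subring (cpredP A)).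

Record elt (A : completing_pred) := Elt { elt_val : T; elt_valP : elt_val \in cpred A }.

HB.instance Definition _ A := [isSub for @elt_val A].
HB.instance Definition _ A := [Choice of elt A by <:].
HB.instance Definition _ A := [SubChoice_isSubComNzRing of elt A by <:].

Variable A : completing_pred.

Definition elt_unit : {pred elt A} := fun x => `[< exists y, y * x = 1 >].
Definition elt_inv (x : elt A) : elt A :=
  if pselect (exists y, y * x = 1) is left h then sval (cid h) else x.

Lemma elt_mulVr : {in elt_unit, left_inverse 1 elt_inv *%R}.
Proof.
move=> x /asboolP xu; rewrite /elt_inv; case: pselect => // h.
by case: cid.
Qed.

Lemma elt_unitP (x y : elt A) : y * x = 1 -> elt_unit x.
Proof. by move=> yx; apply/asboolP; exists y. Qed.

Lemma elt_inv_out : {in [predC elt_unit], elt_inv =1 id}.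
Proof. by move=> x /negP nx; rewrite /elt_inv; case: pselect => // h; case: nx; exact/asboolP. Qed.

HB.instance Definition _ :=
  GRing.ComNzRing_hasMulInverse.Build (elt A) elt_mulVr elt_unitP elt_inv_out.

Lemma elt_mulf_eq0 : GRing.integral_domain_axiom (elt A).
Proof.
move=> x y xy; have [//|x0] := eqVneq x 0; apply/eqP/val_inj.
have xreg : GRing.lreg (val x).
  by apply: (completing_regular (cpredP A)); [exact: elt_valP|exact: x0].
by apply: xreg; rewrite mulr0 -rmorphM xy rmorph0.
Qed.

HB.instance Definition _ := GRing.ComUnitRing_isIntegral.Build (elt A) elt_mulf_eq0.

Definition elt_max : {pred elt A} := fun x => val x \in M.

Lemma in_elt_max x : (x \in elt_max) = (val x \in M).
Proof. by []. Qed.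

Lemma elt_max_idealr : idealr_closed elt_max.
Proof.
split; rewrite ?in_elt_max ?rmorph0 ?rmorph1 ?idealr0 ?idealr1 // => a u v.
by rewrite !in_elt_max rmorphD rmorphM => uM vM; rewrite rpredD // idealMr.
Qed.

HB.instance Definition _ := isIdealr.Build (elt A) elt_max elt_max_idealr.

Hypothesis T_local : is_local M.

Lemma elt_ideal_span (s : seq (elt A)) c :
  ideal_span (map val s) (val c) -> ideal_span s c.
Proof.
move=> sc; have [x /mapP[y _ ->]||b [bA bE]] := completing_span (cpredP A) _ _ sc.
- exact: elt_valP.
- exact: elt_valP.
exists (fun i => Elt (bA i)); apply: val_inj; rewrite rmorph_sum bE size_map.
by apply: eq_bigr => i _; rewrite rmorphM /= (nth_map 0).
Qed.

(** The extension of [I] to [T] is spanned by finitely many elements of [I], and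
these span [I] because linear equations descend. *)
Lemma elt_noetherian : noetherian (elt A).
Proof.
move=> I I_id; have [noethT _ _] := T_local.
have [s [sI Is]] := noetherian_finite_subset noethT [set val x | x in I].
have [l [lI ls]] : exists l : seq (elt A), (forall x, x \in l -> I x) /\ map val l = s.
  elim: s sI {Is} => [|x s IH] sI; first by exists [::].
  have [|l [lI <-]] := IH; first by move=> y ys; apply: sI; rewrite inE ys orbT.
  have [y Iy yx] := sI x (mem_head _ _); exists (y :: l); rewrite -yx; split=> // u.
  by rewrite inE => /orP[/eqP->|/lI].
exists l; apply/seteqP; split; last exact: ideal_span_sub.
by move=> x Ix; apply: elt_ideal_span; rewrite ls; apply: Is; exists x.
Qed.

Lemma elt_local_unit (x : elt A) : x \notin elt_max -> exists y, y * x = 1.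
Proof.
rewrite in_elt_max => /(local_unit T_local)[y xy].
have [|c] := @elt_ideal_span [:: x] 1.
  by exists (fun=> y); rewrite rmorph1 big_ord1 mulrC xy.
by rewrite big_ord1 => c1; exists (c 0%N).
Qed.

Lemma elt_is_local : is_local (elt_max : idealr (elt A)).
Proof.
have sub (N : idealr (elt A)) : {subset N <= elt_max}.
  move=> x xN; apply: contrapT => /negP/elt_local_unit[y yx].
  by have := idealMr y xN; rewrite yx idealr1.
split; first exact: elt_noetherian.
  by move=> I MI x; apply/idP/idP; [exact: sub|exact: MI].
by move=> N Nmax x; rewrite (Nmax _ (@sub N)).
Qed.

(** * The completion of the subring *)

Local Notation m := (elt_max : idealr (elt A)).
Local Notation powm := (ideal_pow [set` m]).
Local Notation powM := (ideal_pow [set` M]).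

Lemma pow_val k x : powm k x -> powM k (val x).
Proof.
elim: k x => // k IH _ [n [a [b [ab ->]]]].
exists n, (val \o a), (val \o b); split=> [i|].
  by have [ai bi] := ab i; split; [exact: ai|exact: IH].
by rewrite rmorph_sum; apply: eq_bigr => i _; rewrite rmorphM.
Qed.

(** [M ^ k] is the extension of [m ^ k] because the subring contains generators of
[M]; closure under solving linear equations then gives [M ^ k] contracting back
to [m ^ k]. *)
Lemma pow_extension k x : powM k x -> exists s : seq (T * elt A),
  (forall p, p \in s -> powm k p.2) /\ x = \sum_(p <- s) p.1 * val p.2.
Proof.
elim: k x => [|k IH] x.
  move=> _; exists [:: (x, 1)]; split; first by [].
  by rewrite big_seq1 rmorph1 mulr1.
have [gs [gsA Mgs]] := completing_gens (cpredP A).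
pose ext := [set x : T | exists s : seq (T * elt A),
  (forall p, p \in s -> powm k.+1 p.2) /\ x = \sum_(p <- s) p.1 * val p.2].
have ext_id : is_ideal ext.
  split.
  - by exists [::]; split=> //; rewrite big_nil.
  - move=> _ _ [s [sk ->]] [t [tk ->]]; exists (s ++ t); rewrite big_cat; split=> // p.
    by rewrite mem_cat => /orP[/sk|/tk].
  - move=> a _ [s [sk ->]]; exists [seq (a * p.1, p.2) | p <- s]; split.
      by move=> _ /mapP[p /sk pk ->].
    by rewrite big_map mulr_sumr; apply: eq_bigr => p _; rewrite mulrA.
have [_ _ extM] := ext_id.
move=> [n [a [b [ab ->]]]]; apply: (ideal_sum ext_id) => i _.
have [ai /IH[s [sk ->]]] := ab i; rewrite mulr_sumr.
rewrite big_seq; apply: (ideal_sum ext_id) => p /sk pk; rewrite mulrCA; apply: (extM).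
have [c ->] := Mgs _ ai; rewrite mulr_suml; apply: (ideal_sum ext_id) => j _.
rewrite -mulrA; apply: extM; have [gA gM] := gsA _ (mem_nth 0 (ltn_ord j)).
exists [:: (1, Elt gA * p.2)]; split; last by rewrite big_seq1 mul1r rmorphM.
by move=> _ /[!inE] /eqP->; exact: ideal_powS.
Qed.

Lemma pow_contraction k (x : elt A) : powM k (val x) -> powm k x.
Proof.
move=> /pow_extension[s [sk xE]].
have : ideal_span (map snd s) x.
  apply: elt_ideal_span; rewrite xE -map_comp; exists (fun i => (nth (0, 0) s i).1).
  rewrite size_map (big_nth (0, 0)) big_mkord.
  by apply: eq_bigr => i _; rewrite (nth_map (0, 0)).
apply: ideal_span_sub; first exact: ideal_powP.
by move=> _ /mapP[p /sk pk ->].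
Qed.

(** Passing from [k] to [k.+1]: the error is a combination of elements of
[m ^ k], and each coefficient is corrected modulo [M] by an element of the
subring. *)
Lemma elt_dense k x : exists a : elt A, powM k (x - val a).
Proof.
elim: k x => [|k IH] x; first by exists 0.
have [a /pow_extension[s [sk xE]]] := IH x.
suff [b xb] : exists b : elt A, powM k.+1 (x - val a - val b).
  by exists (a + b); rewrite rmorphD opprD addrA.
rewrite xE; elim: s sk {xE} => [|[c w] s IHs] sk.
  by exists 0; rewrite big_nil rmorph0 subrr; have [] := ideal_powP M k.+1.
have [|b sb] := IHs; first by move=> p ps; apply: sk; rewrite inE ps orbT.
have [r rA cr] := completing_residue (cpredP A) c.
exists (Elt rA * w + b); rewrite big_cons rmorphD rmorphM /=.
have -> : c * val w + \sum_(p <- s) p.1 * val p.2 - (r * val w + val b) =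
    (c - r) * val w + (\sum_(p <- s) p.1 * val p.2 - val b) by ring.
have [_ powD _] := ideal_powP M k.+1; apply: powD => //.
by apply: ideal_powS => //; apply: pow_val; exact: (sk (c, w) (mem_head _ _)).
Qed.

Hypothesis T_complete : adic_complete M.

Lemma exists_elt_limit (u : cauchy_seq m) : exists l, adic_cvg M (val \o u) l.
Proof.
apply: T_complete.2 => k; have /asboolP/(_ k)[N uN] := cauchy_valP u.
by exists N => i j iN jN; have := pow_val (uN i j iN jN); rewrite rmorphB.
Qed.

Definition elt_limit (u : cauchy_seq m) : T := sval (cid (exists_elt_limit u)).

Lemma elt_limitP (u : cauchy_seq m) : adic_cvg M (val \o u) (elt_limit u).
Proof. exact: (svalP (cid (exists_elt_limit u))). Qed.

Lemma adic_cvg_unique (u : nat -> T) l l' : adic_cvg M u l -> adic_cvg M u l' -> l = l'.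
Proof.
move=> ul ul'; apply/eqP; rewrite -subr_eq0; apply/eqP; apply: T_complete.1 => k.
have [N uN] := ul k; have [N' uN'] := ul' k.
have idk := ideal_powP M k.
have -> : l - l' = (u (maxn N N') - l') - (u (maxn N N') - l) by ring.
by apply: (idealB idk); [apply: uN'; exact: leq_maxr|apply: uN; exact: leq_maxl].
Qed.

Lemma adic_cvgB (u v : nat -> T) l l' : adic_cvg M u l -> adic_cvg M v l' ->
  adic_cvg M (fun i => u i - v i) (l - l').
Proof.
move=> ul vl' k; have [N uN] := ul k; have [N' vN'] := vl' k.
exists (maxn N N') => i; rewrite geq_max => /andP[iN iN'].
have -> : u i - v i - (l - l') = (u i - l) - (v i - l') by ring.
by apply: (idealB (ideal_powP M k)); [exact: uN|exact: vN'].
Qed.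

Lemma adic_cvgM (u v : nat -> T) l l' : adic_cvg M u l -> adic_cvg M v l' ->
  adic_cvg M (fun i => u i * v i) (l * l').
Proof.
move=> ul vl' k; have [N uN] := ul k; have [N' vN'] := vl' k.
exists (maxn N N') => i; rewrite geq_max => /andP[iN iN'].
have -> : u i * v i - l * l' = v i * (u i - l) + l * (v i - l') by ring.
have [_ powD powMl] := ideal_powP M k.
by apply: powD; apply: powMl; [exact: uN|exact: vN'].
Qed.

(** Null sequences are the same for the two topologies since [M ^ k] contracts to
[m ^ k]; this is the injectivity of the comparison map. *)
Lemma elt_limit_eq0 (u : cauchy_seq m) : elt_limit u = 0 <-> u \in @null_pred _ m.
Proof.
split=> [u0|/asboolP u0].
  apply/asboolP => k; have [N uN] := elt_limitP u k; exists N => i iN.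
  by rewrite subr0; apply: pow_contraction; have := uN i iN; rewrite u0 subr0.
apply: adic_cvg_unique (elt_limitP u) _ => k; have [N uN] := u0 k; exists N => i iN.
by have := pow_val (uN i iN); rewrite !subr0.
Qed.

Lemma elt_limitB (u v : cauchy_seq m) : elt_limit (u - v) = elt_limit u - elt_limit v.
Proof.
apply: adic_cvg_unique (elt_limitP _) _; have := adic_cvgB (elt_limitP u) (elt_limitP v).
by congr (adic_cvg M _ _); apply/funext => i; exact: (esym (rmorphB val (u i) (v i))).
Qed.

Lemma elt_limitM (u v : cauchy_seq m) : elt_limit (u * v) = elt_limit u * elt_limit v.
Proof.
apply: adic_cvg_unique (elt_limitP _) _; have := adic_cvgM (elt_limitP u) (elt_limitP v).
by congr (adic_cvg M _ _); apply/funext => i; exact: (esym (rmorphM val (u i) (v i))).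
Qed.

Lemma elt_limit1 : elt_limit 1 = 1.
Proof.
apply: adic_cvg_unique (elt_limitP _) _ => k; exists 0%N => i _.
by rewrite [X in X - _](rmorph1 (val : elt A -> T)) subrr; have [] := ideal_powP M k.
Qed.

Lemma elt_limit_surj x : exists u, elt_limit u = x.
Proof.
have [a aP] := choice (fun k => elt_dense k x).
have a_le k i : (k <= i)%N -> powM k (val (a i) - x).
  move=> ki; rewrite -opprB; apply: (idealN (ideal_powP M k)).
  exact: ideal_pow_le ki _ (aP i).
have aC : a \in cauchy_pred m.
  apply/asboolP => k; exists k => i j ki kj; apply: pow_contraction.
  rewrite rmorphB (_ : _ - _ = (val (a i) - x) - (val (a j) - x)); last by ring.
  by apply: (idealB (ideal_powP M k)); exact: a_le.
exists (CauchySeq aC); apply: adic_cvg_unique (elt_limitP _) _ => k.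
by exists k => i; exact: a_le.
Qed.

Lemma elt_limit_pi (u : cauchy_seq m) : elt_limit (repr (\pi_(adic_completion m) u)%qT) = elt_limit u.
Proof.
apply/eqP; rewrite -subr_eq0 -elt_limitB; apply/eqP/elt_limit_eq0.
by rewrite Quotient.idealrBE reprK.
Qed.

Lemma elt_is_completion : is_completion T m.
Proof.
pose f (x : adic_completion m) := elt_limit (repr x).
have fpi (u : cauchy_seq m) : f (\pi u)%qT = elt_limit u := elt_limit_pi u.
have fB : zmod_morphism f.
  by elim/quotW=> u; elim/quotW=> v; rewrite -rmorphB !fpi elt_limitB.
have fM : monoid_morphism f.
  split; first by rewrite -(rmorph1 (\pi_(adic_completion m))%qT) fpi elt_limit1.
  by elim/quotW=> u; elim/quotW=> v; rewrite -rmorphM !fpi elt_limitM.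
pose F : {rmorphism adic_completion m -> T} := HB.pack f
  (GRing.isZmodMorphism.Build _ _ f fB) (GRing.isMonoidMorphism.Build _ _ f fM).
exists F; have finj : injective f.
  elim/quotW=> u; elim/quotW=> v; rewrite !fpi => uv; apply/eqP.
  rewrite -Quotient.idealrBE; apply/elt_limit_eq0.
  by rewrite elt_limitB uv subrr.
have /choice[g gK] x : exists y, f y = x.
  by have [u <-] := elt_limit_surj x; exists (\pi u)%qT.
by exists g => // y; apply: finj; rewrite gK.
Qed.

End Elements.

Theorem theorem2p13 (T : comNzRingType) (M : idealr T)
    (T_local : is_local M) (T_complete : adic_complete M)
    (T_int : forall z : int, z%:~R != 0 :> T -> ~ zero_divisor (z%:~R : T))
    (M_ass : [set` M] <> [set 0] -> ~ associated_prime M) :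
  (infinite_set [set: {ideal_quot M}] ->
     exists (A : idomainType) (m : idealr A),
       [/\ is_local m, is_completion T m & [set: A] #= [set: {ideal_quot M}]])
  /\
  (finite_set [set: {ideal_quot M}] ->
     exists (A : idomainType) (m : idealr A),
       [/\ is_local m, is_completion T m & countable [set: A]]).
Proof.
have [B Bcompleting] := exists_completing T_local T_complete T_int M_ass.
have [H Hcompleting Htree] := completing_shrink Bcompleting.
pose A := CompletingPred Hcompleting.
have Atree : embeds (elt A) (GenTree.tree {ideal_quot M}).
  apply: embeds_trans Htree.
  by exists (fun x : elt A => exist _ (val x) (elt_valP x)) => x y [/val_inj].
have kA : embeds {ideal_quot M} (elt A).
  apply: (embeds_of_surj (f := fun x : elt A => (\pi_{ideal_quot M} (val x))%qT)) => r.
  have [a aH ra] := completing_residue Hcompleting (repr r).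
  by exists (@Elt _ _ A a aH); rewrite -[RHS]reprK; apply/esym/pi_eq.
split=> [/infinite_embeds natk|fink]; exists (elt A : idomainType), (@elt_max _ _ A);
  split; try exact: elt_is_local; try exact: elt_is_completion.
- rewrite card_eq_le; apply/andP; split; last exact/embeds_cardP.
  by apply/embeds_cardP/(embeds_trans Atree)/embeds_tree_le/embeds_refl.
- apply/countable_embeds/(embeds_trans Atree)/embeds_tree_le; first exact: embeds_refl.
  exact/countable_embeds/finite_set_countable.
Qed.
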